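(* Let $d,B,R>0$ and let $B'\geq 16\max\{n^{5/2+2d}d^{2d},\,B^2R^2/\sqrt{n}\}$ be a multiple of $B$. Let $\mathcal{L}=\frac{1}{B}\mathbb{Z}^n$ and $\mathcal{L}'=\frac{1}{B'}\mathbb{Z}^n$. Given $\varepsilon>0$, query access to a function $f:\mathbb{R}^n\to\mathbb{R}$, and sample access to an unknown $(\varepsilon/4,R)$-concentrated distribution $\mathcal{D}$ supported on $\mathcal{L}$, there is a one-sided error tester making $O\!\left(d^5+\frac{d^2}{\varepsilon}\log\frac{1}{\varepsilon}\right)$ queries for testing whether $f$ agrees on $\mathcal{L}$ with a polynomial of degree at most $d$, or is $\varepsilon$-far from degree-$d$ polynomials over $\mathcal{D}$. The tester queries $f$ only on points of $\mathcal{L}'$.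
   Context: $\mathcal{B}(\mathbf{c},r)$ denotes the open Euclidean ball of radius $r$ centered at $\mathbf{c}$. A distribution $\mathcal{D}$ is $(\varepsilon,R)$-concentrated if $\Pr_{\mathbf{p}\sim\mathcal{D}}[\mathbf{p}\in\mathcal{B}(\mathbf{0},R)]\geq 1-\varepsilon$. $f$ is $\varepsilon$-far from degree-$d$ polynomials over $\mathcal{D}$ if for every polynomial $g$ of total degree at most $d$, $\Pr_{\mathbf{x}\sim\mathcal{D}}[f(\mathbf{x})\neq g(\mathbf{x})]>\varepsilon$. A one-sided error tester accepts with probability $1$ if $f$ agrees with a degree-$d$ polynomial on $\mathcal{L}$ and rejects with probability at least $2/3$ if $f$ is $\varepsilon$-far. Query complexity counts queries to $f$. *)

(* Defs.v *)
From HB Require Import structures.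
From mathcomp Require Import all_boot all_order all_algebra.
From mathcomp Require Import all_classical all_reals all_analysis.
(* The notations of [mpoly] clash with those of Analysis. *)
From mathcomp Require Import(canonicals, coercions) mpoly.

Set Implicit Arguments.
Unset Strict Implicit.
Unset Printing Implicit Defensive.

Import Order.TTheory GRing.Theory Num.Theory.

Local Open Scope classical_set_scope.
Local Open Scope ring_scope.

(* Discrete probability distributions.  A distribution supported on a lattice
   is of this kind; all subsets are then events, so that no measurability is
   required of the tested function. *)
Record discrete_distribution (R : realType) (T : choiceType) :=
  DiscreteDistribution {
  pmf :> T -> R;
  pmf_ge0 : forall x, 0 <= pmf x;
  pmf_sum1 : (\esum_(x in [set: T]) (pmf x)%:E = 1)%E
}.

Definition Pr (R : realType) (T : choiceType) (D : discrete_distribution R T)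
    (A : set T) : \bar R :=
  (\esum_(x in A) (D x)%:E)%E.

Definition supported_on (R : realType) (T : choiceType)
    (D : discrete_distribution R T) (A : set T) : Prop :=
  forall x, ~ A x -> D x = 0.

Section Space.
Variables (R : realType) (n : nat).

(* The norm provided by the library on row vectors is the sup norm. *)
Definition euclidean_norm (x : 'rV[R]_n) : R :=
  Num.sqrt (\sum_(i < n) x ord0 i ^+ 2).

Definition eball (c : 'rV[R]_n) (r : R) : set 'rV[R]_n :=
  [set x | euclidean_norm (x - c) < r].

Definition concentrated (e r : R) (D : discrete_distribution R 'rV[R]_n) : Prop :=
  ((1 - e)%:E <= Pr D (eball 0 r))%E.

(* (1/B) Z^n *)
Definition lattice (B : R) : set 'rV[R]_n :=
  [set B^-1 *: map_mx intr z | z in [set: 'rV[int]_n]].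

(* [mpoly.msize p] is one plus the total degree of [p], and 0 for [p = 0]. *)
Definition deg_le (d : nat) (p : mpoly.mpoly n R) : bool :=
  (mpoly.msize p <= d.+1)%N.

Definition peval (p : mpoly.mpoly n R) (x : 'rV[R]_n) : R :=
  mpoly.meval (fun i => x ord0 i) p.

Definition agrees_with_degree (d : nat) (f : 'rV[R]_n -> R)
    (A : set 'rV[R]_n) : Prop :=
  exists2 p : mpoly.mpoly n R, deg_le d p & forall x, A x -> f x = peval p x.

Definition far_from_degree (d : nat) (e : R) (f : 'rV[R]_n -> R)
    (D : discrete_distribution R 'rV[R]_n) : Prop :=
  forall p : mpoly.mpoly n R, deg_le d p ->
    (e%:E < Pr D [set x | f x <> peval p x])%E.

(* Randomized adaptive algorithms with query access to a function and sample
   access to a distribution, as possibly infinitely branching trees.  [Draw]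
   is internal randomness: any distribution on a countable set, encoded in
   [nat].  [Output true] means acceptance. *)
Inductive algorithm : Type :=
| Output of bool
| Query of 'rV[R]_n & (R -> algorithm)
| Sample of ('rV[R]_n -> algorithm)
| Draw of discrete_distribution R nat & (nat -> algorithm).

Section Semantics.
Variables (f : 'rV[R]_n -> R) (D : discrete_distribution R 'rV[R]_n).

(* Successive samples and draws are mutually independent. *)
Fixpoint outcome_prob (t : algorithm) (b : bool) : \bar R :=
  match t with
  | Output b' => (b' == b)%:R%:E
  | Query x k => outcome_prob (k (f x)) b
  | Sample k =>
      (\esum_(x in [set: 'rV[R]_n]) ((D x)%:E * outcome_prob (k x) b))%E
  | Draw p k =>
      (\esum_(i in [set: nat]) ((p i)%:E * outcome_prob (k i) b))%E
  end.

(* [execution t s]: with positive probability, the points queried by [t] are,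
   in order, those of [s]. *)
Inductive execution : algorithm -> seq 'rV[R]_n -> Prop :=
| ExecOutput b : execution (Output b) [::]
| ExecQuery x k s : execution (k (f x)) s -> execution (Query x k) (x :: s)
| ExecSample k x s : 0 < D x -> execution (k x) s -> execution (Sample k) s
| ExecDraw (p : discrete_distribution R nat) k i s :
    0 < p i -> execution (k i) s -> execution (Draw p k) s.

End Semantics.

Definition accept_prob f D t := outcome_prob f D t true.
Definition reject_prob f D t := outcome_prob f D t false.

Definition query_complexity_le (f : 'rV[R]_n -> R)
    (D : discrete_distribution R 'rV[R]_n) (t : algorithm) (q : R) : Prop :=
  forall s, execution f D t s -> (size s)%:R <= q.

Definition queries_only_in (f : 'rV[R]_n -> R)
    (D : discrete_distribution R 'rV[R]_n) (t : algorithm)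
    (A : set 'rV[R]_n) : Prop :=
  forall s, execution f D t s -> forall x, x \in s -> A x.

(* [H] is the class of distributions the tester must handle. *)
Definition one_sided_tester (d : nat) (e : R) (L : set 'rV[R]_n)
    (H : set (discrete_distribution R 'rV[R]_n)) (t : algorithm) : Prop :=
  forall (f : 'rV[R]_n -> R) (D : discrete_distribution R 'rV[R]_n), H D ->
    (agrees_with_degree d f L -> accept_prob f D t = 1%E) /\
    (far_from_degree d e f D -> ((2 / 3)%:E <= reject_prob f D t)%E).

End Space.

(* Main.v *)
(** A function agreeing with a polynomial on [L] may be arbitrary on [L'] minus
    [L], so the tester queries [L] only, identified with Z^n; no bound on the
    size of the queried points is needed, so uniform points of a huge box can
    be used, whose law is almost invariant under bounded translations.

    Multiplication by an integer does not preserve such a law, so a value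
    cannot be corrected along a single random line.  Instead, the value at [x]
    of a polynomial of degree at most [d] is a fixed combination of its values
    at the [(d + 1)^2] points [x + c H], where [c] runs over primitive vectors
    of Z^2 and [H] is a 2 x n matrix: interpolate along the line through [x] in
    the first direction, and then replace each node by an interpolation in the
    second one at parameters chosen to make [c] primitive.  As [c u = 1] for
    some integer vector [u], [x + c H = c (H + u x)], and translating [x] costs
    nothing.

    The tester compares [f] at random [c H] with its corrected value, checks
    the line identity from [c H] in direction [c K], and finally compares [f]
    with its corrected value at samples of the distribution.  If the first two
    checks seldom fail, then for [x] in a bounded region the corrected value
    does not depend on [H], up to rare exceptions, and satisfies the line
    identity; hence it is a polynomial of degree at most [d] there. *)

Require Import Defs.
From mathcomp Require Import all_boot all_order all_algebra.
From mathcomp Require Import all_classical all_reals all_analysis.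
From mathcomp Require Import zify ring lra.
From mathcomp Require Import(canonicals, coercions) mpoly.

Set Implicit Arguments.
Unset Strict Implicit.
Unset Printing Implicit Defensive.

Import Order.TTheory GRing.Theory Num.Theory.

Local Open Scope classical_set_scope.
Local Open Scope ring_scope.

(** * Univariate Lagrange interpolation at integer nodes *)

Section Interpolation.
Variable R : realType.

(** Coefficients of the extrapolation to 0 from the nodes [s 0], ..., [s d]. *)
Definition weight0 (d : nat) (s : nat -> R) (i : 'I_d.+1) : R :=
  (tnth (qpoly.lagrange d.+1 s) i : {poly R}).[0].

Lemma weight0P (d : nat) (s : nat -> R) (q : {poly R}) :
  injective s -> (size q <= d.+1)%N ->
  q.[0] = \sum_(i < d.+1) weight0 s i * q.[s i].
Proof.
move=> s_inj sq; rewrite {1}(lagrange_gen (ltn0Sn d) s_inj sq) horner_sum.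
by apply: eq_bigr => i _; rewrite hornerM hornerC mulrC.
Qed.

Lemma natr_inj : injective (fun t : nat => t%:R : R).
Proof. by move=> a b /eqP; rewrite eqr_nat => /eqP. Qed.

Lemma natrS_inj : injective (fun t : nat => t.+1%:R : R).
Proof. by move=> a b /eqP; rewrite eqr_nat => /eqP[]. Qed.

(** Explicitly (-1)^i binom(d+1, i+1): the resulting identity is the vanishing of the finite
    difference of order d + 1. *)
Definition alpha (d : nat) : 'I_d.+1 -> R := weight0 (fun t => t.+1%:R).

Definition basis (d : nat) (j : 'I_d.+1) : {poly R} :=
  tnth (qpoly.lagrange d.+1 (fun t : nat => t%:R : R)) j.

Lemma size_basis d (j : 'I_d.+1) : size (basis j) = d.+1.
Proof. by rewrite /basis size_lagrange_ //; exact: natr_inj. Qed.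

Lemma basis_sample d (j k : 'I_d.+1) : (basis j).[k%:R] = (j == k)%:R.
Proof. exact: (lagrange_sample (ltn0Sn d) natr_inj). Qed.

Lemma basis_gen d (q : {poly R}) : (size q <= d.+1)%N ->
  q = \sum_(j < d.+1) q.[j%:R] *: basis j.
Proof.
move=> /(lagrange_gen (ltn0Sn d) natr_inj) {1}->.
by apply: eq_bigr => j _; rewrite mul_polyC.
Qed.

(** Composing [q] with t -> s + c t does not raise the degree, so the extrapolation from 1, ..., d +
    1 to 0 carries over to any base point and step. *)
Lemma alphaP d (q : {poly R}) (s c : R) : (size q <= d.+1)%N ->
  q.[s] = \sum_(i < d.+1) alpha i * q.[s + c * i.+1%:R].
Proof.
move=> sq; pose r : {poly R} := c *: 'X + s%:P; pose p := q \Po r.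
have pE t : p.[t] = q.[s + c * t].
  by rewrite /p /r horner_comp !hornerE addrC.
have s2 : ((size r).-1 <= 1)%N.
  suff: (size r <= 2)%N by case: size.
  rewrite (leq_trans (size_polyD _ _)) // geq_max.
  rewrite (leq_trans (size_scale_leq _ _)) ?size_polyX //=.
  by rewrite (leq_trans (size_polyC_leq1 _)).
have sp : (size p <= d.+1)%N.
  apply: leq_trans (size_comp_poly_leq _ _) _; rewrite ltnS.
  apply: leq_trans (leq_mul (leqnn _) s2) _; rewrite muln1.
  by move: sq; case: size.
have := weight0P natrS_inj sp; rewrite pE mulr0 addr0 => ->.
by apply: eq_bigr => i _; rewrite pE.
Qed.

(* Downwards from 0 and upwards from [d], each value is determined by the next
   [d + 1] ones. *)
Lemma ladder d (X : nat) (u : int -> R) :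
  (forall s c : int, (`|s| <= X)%N -> c = 1 \/ c = -1 ->
    u s = \sum_(i < d.+1) alpha i * u (s + c * i.+1%:Z)) ->
  (forall j : 'I_d.+1, u j%:Z = 0) ->
  forall s : int, (`|s| <= X)%N -> u s = 0.
Proof.
move=> hu u0.
have up : forall s : nat, (s <= X)%N -> u s%:Z = 0.
  elim/ltn_ind => s IH sX; have [sd|ds] := ltnP s d.+1.
    exact: (u0 (Ordinal sd)).
  rewrite (hu _ (-1)) //; last by right.
  rewrite big1 // => i _; have id := ltn_ord i.
  have -> : (s%:Z + -1 * i.+1%:Z)%R = (s - i.+1)%N%:Z by lia.
  by rewrite IH ?mulr0 //; lia.
have dn : forall s : nat, (s <= X)%N -> u (- s%:Z) = 0.
  elim/ltn_ind => s IH sX; case: (posnP s) => [->|s0].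
    exact: (u0 ord0).
  rewrite (hu _ 1) //; [|lia|by left].
  rewrite big1 // => i _; have id := ltn_ord i.
  have [si|is_] := leqP s i.+1.
    have -> : (- s%:Z + 1 * i.+1%:Z)%R = (i.+1 - s)%N%:Z by lia.
    have k : (i.+1 - s < d.+1)%N by lia.
    by rewrite (u0 (Ordinal k)) mulr0.
  have -> : (- s%:Z + 1 * i.+1%:Z)%R = - (s - i.+1)%N%:Z by lia.
  by rewrite IH ?mulr0 //; lia.
move=> s; case: (intP s) => [|k|k] sX; first exact: (up 0%N).
  by apply: up; lia.
by apply: dn; lia.
Qed.

(** By [alphaP] the interpolant at 0, ..., d satisfies the same recurrence as [u], so [ladder]
    applies to the difference. *)
Lemma ladder_interp d (X : nat) (u : int -> R) :
  (forall s c : int, (`|s| <= X)%N -> c = 1 \/ c = -1 ->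
    u s = \sum_(i < d.+1) alpha i * u (s + c * i.+1%:Z)) ->
  forall s : int, (`|s| <= X)%N ->
  u s = (\sum_(j < d.+1) u j%:Z *: basis j).[s%:~R].
Proof.
move=> hu s sX; set q := \sum_j _.
have sq : (size q <= d.+1)%N.
  apply: (leq_trans (size_sum _ _ _)); apply/bigmax_leqP => j _.
  by rewrite (leq_trans (size_scale_leq _ _)) // size_basis.
apply/eqP; rewrite -subr_eq0; apply/eqP.
apply: (@ladder d X (fun s => u s - q.[s%:~R])) sX => [t c tX hc|j].
  rewrite (hu _ _ tX hc) (alphaP t%:~R c%:~R sq) -sumrB.
  by apply: eq_bigr => i _; rewrite rmorphD rmorphM /= mulrBr.
rewrite horner_sum (bigD1 j) //= hornerZ big1 => [|i ij].
  by rewrite -[j%:Z%:~R]/(j%:R : R) basis_sample eqxx mulr1 addr0 subrr.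
by rewrite hornerZ -[j%:Z%:~R]/(j%:R : R) basis_sample (negPf ij) mulr0.
Qed.

End Interpolation.

(** * From line identities on a box to a polynomial of total degree at most d *)

Section LineTest.
Variables (R : realType) (n d : nat).

Definition inbox p (X : nat) (x : 'M[int]_(p, n)) : Prop :=
  forall i j, (`|x i j| <= X)%N.

Definition line_interp (F : 'rV[int]_n -> R) (x y : 'rV[int]_n) : R :=
  \sum_(i < d.+1) alpha R i * F (x + i.+1%:Z *: y).

Definition set_coord (z : 'rV[int]_n) (k : 'I_n) (s : int) : 'rV[int]_n :=
  \row_i if i == k then s else z ord0 i.

Notation grid := {ffun 'I_n -> 'I_d.+1}.

Definition grid_point (j : grid) : 'rV[int]_n := \row_i (j i : nat)%:Z.

Variables (X : nat) (g : 'rV[int]_n -> R).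
Hypotheses (X_gt0 : (0 < X)%N) (dX : (d <= X)%N) (ndX : (n * d * d <= X)%N).
Hypothesis g_lines :
  forall x y, inbox X x -> inbox X y -> g x = line_interp g x y.

(** The line identity in the directions plus and minus the k-th unit vector is the hypothesis of
    [ladder_interp] for [g] on an axis-parallel line. *)
Lemma axis_interp z k : inbox X z ->
  g z = \sum_(j < d.+1) g (set_coord z k j%:Z) * (basis R j).[(z ord0 k)%:~R].
Proof.
move=> zX.
have zE : z = set_coord z k (z ord0 k).
  by apply/rowP => i; rewrite mxE; case: eqP => // ->.
rewrite {1}zE (@ladder_interp _ d X (fun s => g (set_coord z k s))) //.
  by rewrite horner_sum; apply: eq_bigr => j _; rewrite hornerZ.
move=> s c sX hc; rewrite (g_lines (y := c *: delta_mx ord0 k)).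
- rewrite /line_interp; apply: eq_bigr => i _; congr (_ * g _).
  apply/rowP => l; rewrite !mxE eqxx /=; case: eqP => _ /=.
    by rewrite mulr1 mulrC.
  by rewrite !mulr0 addr0.
- by move=> i l; rewrite ord1 mxE; case: eqP.
- move=> i l; rewrite !mxE abszM; case: hc => ->; case: (_ && _) => //=;
    by rewrite ?muln1 ?muln0.
Qed.

(** Tensor product Lagrange interpolant on {0, ..., d}^n: degree at most d in each variable, the
    total degree being bounded later by [tensor_coef_eq0]. *)
Definition tensor_interp (z : 'rV[int]_n) : R :=
  \sum_(j : grid) g (grid_point j) * \prod_i (basis R (j i)).[(z ord0 i)%:~R].

(** Mirrors [axis_interp]: the k-th factor has degree at most d in its variable, so its
    interpolation at 0, ..., d is exact. *)
Lemma tensor_interp_axis z k : tensor_interp z =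
  \sum_(j < d.+1) tensor_interp (set_coord z k j%:Z) *
                  (basis R j).[(z ord0 k)%:~R].
Proof.
under [RHS]eq_bigr => l _ do rewrite /tensor_interp mulr_suml.
rewrite exchange_big /=; apply: eq_bigr => j _.
under [RHS]eq_bigr => l _ do rewrite -mulrA.
rewrite -mulr_sumr; congr (_ * _); rewrite (bigD1 k) //=.
have sb : (size (basis R (j k)) <= d.+1)%N by rewrite size_basis.
rewrite {1}(basis_gen sb) horner_sum mulr_suml; apply: eq_bigr => l _.
rewrite [in RHS](bigD1 k) //= mxE eqxx hornerZ -!mulrA; congr (_ * _).
rewrite mulrC; congr (_ * _); apply: eq_bigr => i ik.
by rewrite mxE (negPf ik).
Qed.

Lemma tensor_interp_grid j : tensor_interp (grid_point j) = g (grid_point j).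
Proof.
rewrite /tensor_interp (bigD1 j) //= big1 => [|i _]; last first.
  by rewrite mxE -[_%:~R]/((j i)%:R : R) basis_sample eqxx.
rewrite mulr1 big1 ?addr0 // => e ej.
have [i ei] : exists i, e i != j i.
  by apply/existsP; rewrite -negb_forall; apply: contra ej => /eqfunP/ffunP->.
rewrite (bigD1 i) //= mxE -[_%:~R]/((j i)%:R : R) basis_sample (negPf ei).
by rewrite mul0r mulr0.
Qed.

Lemma tensor_interpP z : inbox X z -> g z = tensor_interp z.
Proof.
(* Induction on the number m of leading coordinates that may lie outside {0, ..., d}; the two axis
   expansions bring one more coordinate into that range. *)
suff H m : forall z, inbox X z ->
    (forall i : 'I_n, (m <= i)%N -> exists c : 'I_d.+1, z ord0 i = c%:Z) ->
    g z = tensor_interp z.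
  by move=> zX; apply: (H n) => // i; rewrite leqNgt ltn_ord.
elim: m => [|m IH] {}z zX hz.
  have [c cP] := choice (fun i => hz i (leq0n i)).
  have -> : z = grid_point [ffun i => c i].
    by apply/rowP => i; rewrite mxE ffunE cP.
  by rewrite tensor_interp_grid.
have [mn|nm] := ltnP m n; last first.
  by apply: IH => // i; rewrite leqNgt (leq_trans (ltn_ord i) nm).
rewrite (axis_interp (Ordinal mn)) // (tensor_interp_axis _ (Ordinal mn)).
apply: eq_bigr => j _; congr (_ * _); apply: IH => [i l|i mi].
  rewrite !mxE; case: eqP => // _; rewrite -?ord1 //=.
  by have := ltn_ord j; lia.
rewrite mxE; case: eqP => [_|/eqP im]; first by exists j.
by apply: hz; rewrite ltn_neqAle mi andbT eq_sym; exact: im.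
Qed.

Definition tensor_coef (e : grid) : R :=
  \sum_(j : grid) g (grid_point j) * \prod_i (basis R (j i))`_(e i).

Definition weight (e : grid) : nat := \sum_i e i.

Lemma tensor_coefP z : tensor_interp z =
  \sum_(e : grid) tensor_coef e * \prod_i (z ord0 i)%:~R ^+ e i.
Proof.
under [RHS]eq_bigr => e _ do rewrite mulr_suml.
rewrite exchange_big /=; apply: eq_bigr => j _.
under [RHS]eq_bigr => e _ do rewrite -mulrA -big_split /=.
rewrite -mulr_sumr; congr (_ * _).
under eq_bigr => i _.
  rewrite (horner_coef_wide _ (eq_leq (size_basis R (j i)))); over.
by rewrite bigA_distr_bigA.
Qed.

Lemma weight_le e : (weight e <= n * d)%N.
Proof.
have : (weight e <= \sum_(i < n) d)%N.
  by apply: leq_sum => i _; rewrite -ltnS ltn_ord.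
by rewrite sum_nat_const card_ord.
Qed.

(* On the line through 0 and a grid point, [g] is a univariate polynomial of
   degree at most [d], so the part of weight [k > d] vanishes on the grid. *)
Lemma tensor_coef_homog (y : grid) k : (d < k)%N ->
  \sum_(e : grid | weight e == k) tensor_coef e * \prod_i (y i)%:R ^+ e i = 0.
Proof.
move=> dk.
pose q : {poly R} := \sum_(e : grid)
  (tensor_coef e * \prod_i (y i)%:R ^+ e i) *: 'X^(weight e).
pose p : {poly R} := \sum_(j < d.+1) g (j%:Z *: grid_point y) *: basis R j.
(* Multiples up to n d are needed because [q] may have degree n d; grid coordinates being at most d,
   this is the source of the bound n d d on the box. *)
have yX s : (`|s| <= n * d)%N -> inbox X (s *: grid_point y).
  move=> sX i l; rewrite !mxE abszM /= (leq_trans _ ndX) // leq_mul //.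
  by rewrite -ltnS ltn_ord.
have qg (s : int) : (`|s| <= n * d)%N -> q.[s%:~R] = g (s *: grid_point y).
  move=> sX; rewrite tensor_interpP ?tensor_coefP; last exact: yX.
  rewrite horner_sum; apply: eq_bigr => e _.
  rewrite hornerZ hornerXn -mulrA; congr (_ * _).
  rewrite expr_sum -big_split /=; apply: eq_bigr => i _.
  by rewrite !mxE rmorphM exprMn mulrC.
have pg (s : int) : (`|s| <= n * d)%N -> g (s *: grid_point y) = p.[s%:~R].
  move=> sX; apply: (ladder_interp (u := fun s => g (s *: grid_point y)) _ sX).
  move=> t c tX hc; rewrite (g_lines (y := c *: grid_point y)).
  - rewrite /line_interp; apply: eq_bigr => i _; congr (_ * g _).
    by rewrite scalerDl scalerA mulrC.
  - exact: yX.
  - move=> i l; rewrite !mxE abszM.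
    have -> : `|c|%N = 1%N by case: hc => ->.
    by rewrite mul1n /= (leq_trans _ dX) // -ltnS ltn_ord.
have sp : (size p <= d.+1)%N.
  apply: (leq_trans (size_sum _ _ _)); apply/bigmax_leqP => j _.
  by rewrite (leq_trans (size_scale_leq _ _)) // size_basis.
have [dnd|ndd] := ltnP (n * d) k.
  rewrite big_pred0 // => e; apply/negbTE/eqP => ek.
  by move: (weight_le e); rewrite ek leqNgt dnd.
have sq : (size q <= (n * d).+1)%N.
  apply: (leq_trans (size_sum _ _ _)); apply/bigmax_leqP => e _.
  by rewrite (leq_trans (size_scale_leq _ _)) // size_polyXn ltnS weight_le.
have qp : q = p.
  apply/eqP; rewrite -subr_eq0; apply/eqP.
  apply: (@roots_geq_poly_eq0 _ _ [seq t%:R | t <- iota 0 (n * d).+1]).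
  - apply/allP => _ /mapP[t /[!mem_iota] /andP[_ tn] ->].
    have tX : (`|t%:Z| <= n * d)%N by [].
    by rewrite /root !hornerE -[t%:R]/(t%:Z%:~R : R) qg // pg // subrr.
  - by rewrite map_inj_uniq ?iota_uniq //; exact: natr_inj.
  - rewrite size_map size_iota (leq_trans (size_polyD _ _)) //.
    rewrite size_polyN geq_max.
    by rewrite sq (leq_trans sp) // ltnS (leq_trans (ltnW dk)).
have q0 : q`_k = 0 by rewrite qp nth_default // (leq_trans sp).
rewrite big_mkcond /= -[RHS]q0 /q coef_sum; apply: eq_bigr => e _.
by rewrite coefZ coefXn eq_sym; case: eqP; rewrite ?mulr1 ?mulr0.
Qed.

(** The part of weight [weight e0] vanishes on the grid, and pairing its grid values with
    coefficients of the Lagrange basis extracts the coefficient of [e0]. *)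
Lemma tensor_coef_eq0 (e0 : grid) : (d < weight e0)%N -> tensor_coef e0 = 0.
Proof.
move=> de; pose S (y : grid) := \sum_(e : grid | weight e == weight e0)
  tensor_coef e * \prod_i (y i)%:R ^+ e i.
have : \sum_(y : grid) S y * \prod_i (basis R (y i))`_(e0 i) = 0.
  by rewrite big1 // => y _; rewrite /S tensor_coef_homog // mul0r.
under eq_bigr => y _ do rewrite /S mulr_suml.
rewrite exchange_big /=.
under eq_bigr => e _.
  under eq_bigr => y _ do rewrite -mulrA -big_split /=.
  rewrite -mulr_sumr -(bigA_distr_bigA
    (fun i (t : 'I_d.+1) => t%:R ^+ e i * (basis R t)`_(e0 i))).
  under eq_bigr => i _.
    (* Interpolation of X^(e i) at 0, ..., d is exact as [e i] is at most d; compare the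
       coefficients of X^(e0 i). *)
    rewrite (_ : \sum_t _ = (e i == e0 i)%:R); last first.
      have sX : (size ('X^(e i) : {poly R}) <= d.+1)%N.
        by rewrite size_polyXn ltn_ord.
      have := congr1 (fun q : {poly R} => q`_(e0 i)) (basis_gen sX).
      rewrite /= coef_sum coefXn eq_sym => ->.
      by apply: eq_bigr => t _; rewrite coefZ hornerXn.
    over.
  over.
rewrite (bigD1 e0) //= big1 => [|i _]; last by rewrite eqxx.
rewrite mulr1 big1 ?addr0 // => e /andP[_ ee0].
have [i ei] : exists i, e i != e0 i.
  by apply/existsP; rewrite -negb_forall; apply: contra ee0 => /eqfunP/ffunP->.
by rewrite (bigD1 i) //= (negPf ei) mul0r mulr0.
Qed.

End LineTest.

(** * Probabilities under uniform laws on finite types *)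

Section Frequency.
Variable R : realType.

Definition freq (T : finType) (P : T -> bool) : R :=
  (\sum_(t : T) (P t)%:R) / #|T|%:R.

Lemma freq_ge0 (T : finType) (P : T -> bool) : 0 <= freq P.
Proof. by rewrite divr_ge0 // sumr_ge0. Qed.

Lemma sub_freq (T : finType) (P Q : T -> bool) :
  (forall t, P t -> Q t) -> freq P <= freq Q.
Proof.
move=> PQ; rewrite ler_wpM2r ?invr_ge0 // ler_sum // => t _.
by rewrite ler_nat; have := PQ t; case: (P t) => // ->.
Qed.

Lemma eq_freq (T : finType) (P Q : T -> bool) : P =1 Q -> freq P = freq Q.
Proof. by move=> PQ; congr (_ / _); apply: eq_bigr => t _; rewrite PQ. Qed.

Lemma freqU (T : finType) (P Q : T -> bool) :
  freq (fun t => P t || Q t) <= freq P + freq Q.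
Proof.
rewrite -mulrDl -big_split /= ler_wpM2r ?invr_ge0 // ler_sum // => t _.
by rewrite -natrD ler_nat; case: (P t); case: (Q t).
Qed.

Lemma freq_exists (T I : finType) (P : I -> T -> bool) :
  freq (fun t => [exists i, P i t]) <= \sum_i freq (P i).
Proof.
rewrite -mulr_suml exchange_big /= ler_wpM2r ?invr_ge0 // ler_sum // => t _.
case: existsP => [[i Pit]|_]; last by rewrite sumr_ge0.
by rewrite (bigD1 i) //= Pit lerDl sumr_ge0.
Qed.

Lemma freq_lt1 (T : finType) (P : T -> bool) :
  (0 < #|T|)%N -> freq P < 1 -> exists t, ~~ P t.
Proof.
move=> T0; rewrite ltr_pdivrMr ?ltr0n // mul1r => lt.
apply/existsP; rewrite -negb_forall; apply/negP => /forallP allP.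
move: lt; under eq_bigr => t _ do rewrite allP.
by rewrite sumr_const ltxx.
Qed.

Lemma freq_neg (T : finType) (P : T -> bool) : (0 < #|T|)%N ->
  freq (fun t => ~~ P t) = 1 - freq P.
Proof.
move=> T0; apply/eqP; rewrite eq_sym subr_eq -mulrDl -big_split /=.
rewrite (eq_bigr (fun=> 1)) => [|t _]; last first.
  by case: (P t); rewrite ?add0r ?addr0.
by rewrite sumr_const divff // pnatr_eq0 -lt0n.
Qed.

Lemma freq_pair (A B : finType) (P : A * B -> bool) :
  freq P = (\sum_a freq (fun b => P (a, b))) / #|A|%:R.
Proof.
rewrite /freq -mulr_suml card_prod natrM invfM -mulrA [_^-1 * _]mulrC.
congr (_ * _); rewrite pair_bigA /=.
by apply: eq_bigr => -[].
Qed.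

Lemma freq_swap (A B : finType) (P : A * B -> bool) :
  freq P = freq (fun ba : B * A => P (ba.2, ba.1)).
Proof.
rewrite /freq !card_prod mulnC; congr (_ / _).
rewrite (eq_bigr (fun ab => (P (ab.1, ab.2))%:R)) => [|[] //].
by rewrite -(pair_bigA _ (fun a b => (P (a, b))%:R)) /= exchange_big pair_bigA.
Qed.

Lemma freq_fst (A B : finType) (P : A -> bool) :
  (0 < #|B|)%N -> freq (fun ab : A * B => P ab.1) = freq P.
Proof.
move=> B0; rewrite freq_pair /=; congr (_ / _); apply: eq_bigr => a _.
by rewrite /freq /= sumr_const -[X in X / _]mulr_natr mulfK // pnatr_eq0 -lt0n.
Qed.

(** Averaging over [a]: a translation estimate for one random matrix, proved with the other one
    frozen, passes to the pair. *)
Lemma freq_fibers (A B : finType) (P Q : A * B -> bool) (x : R) :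
  (0 < #|A|)%N ->
  (forall a, freq (fun b => P (a, b)) <= freq (fun b => Q (a, b)) + x) ->
  freq P <= freq Q + x.
Proof.
move=> A0 PQ; have cA : 0 < #|A|%:R :> R by rewrite ltr0n.
rewrite !freq_pair ler_pdivrMr // mulrDl divfK ?gt_eqF //.
by rewrite mulr_natr -sumr_const -big_split ler_sum.
Qed.

(** Some fibre does no worse than the average; this serves to fix one of two random matrices. *)
Lemma freq_exists_fiber (A B : finType) (P : A * B -> bool) :
  (0 < #|A|)%N -> exists a, freq (fun b => P (a, b)) <= freq P.
Proof.
move=> A0; have cA : 0 < #|A|%:R :> R by rewrite ltr0n.
apply/existsP; rewrite -[X in is_true X]negbK negb_exists.
apply/negP => /forallP lt.
have : \sum_(a : A) freq P < \sum_a freq (fun b => P (a, b)).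
  apply: ltr_sum => [|a _]; last by rewrite ltNge lt.
  by apply/hasP; case/card_gt0P: A0 => a; exists a; rewrite ?mem_index_enum.
have PE : freq P * #|A|%:R = \sum_a freq (fun b => P (a, b)).
  by rewrite freq_pair divfK ?gt_eqF.
by rewrite sumr_const -[X in X < _]mulr_natr PE ltxx.
Qed.

(** * Uniform matrices with entries in [0, M), under bounded translations *)

Section Box.
Variables (p n M : nat).
Hypothesis M_gt0 : (0 < M)%N.

Notation box := {ffun 'I_p * 'I_n -> 'I_M}.

Definition box_point (H : box) : 'M[int]_(p, n) :=
  \matrix_(i, j) (H (i, j) : nat)%:Z.

Lemma card_box_gt0 : (0 < #|{: box}|)%N.
Proof. by rewrite card_ffun card_ord expn_gt0 M_gt0. Qed.

Lemma card_interval (P : pred 'I_M) a m :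
  (forall t, P t -> (a <= t < a + m)%N) -> (#|P| <= m)%N.
Proof.
move=> Pam; rewrite cardE -(size_map val) -[leqRHS](size_iota a m).
apply: uniq_leq_size => [|x /mapP[t]].
  by rewrite map_inj_uniq ?enum_uniq //; exact: val_inj.
by rewrite mem_enum mem_iota => Pt ->; exact: Pam.
Qed.

Definition overflows (w : int) (t : 'I_M) : bool :=
  ~~ ((0 <= t%:Z + w) && (t%:Z + w < M%:Z)).

Lemma card_overflows w : (#|overflows w| <= `|w|)%N.
Proof.
have [w0|w0] := lerP 0 w.
  apply: (@card_interval _ (M - `|w|)) => t.
  by rewrite /overflows; have := ltn_ord t; lia.
apply: (@card_interval _ 0) => t.
by rewrite /overflows negb_and -!ltNge -!leNgt; have := ltn_ord t; lia.
Qed.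

(** The sum over all functions factors, and each coordinate other than [k] contributes M to
    numerator and denominator alike. *)
Lemma freq_coord (k : 'I_p * 'I_n) (Q : 'I_M -> bool) :
  freq (fun H : box => Q (H k)) = freq Q.
Proof.
have -> : freq (fun H : box => Q (H k)) =
    (\sum_(H : box) \prod_l (if l == k then (Q (H l))%:R else 1)) /
    #|{: box}|%:R.
  congr (_ / _); apply: eq_bigr => H _.
  by rewrite (bigD1 k) //= eqxx big1 ?mulr1 // => l /negPf ->.
rewrite -(bigA_distr_bigA (fun l t => if l == k then (Q t)%:R else 1)).
rewrite (bigD1 k) //= eqxx.
under [X in _ * X / _]eq_bigr => l /negPf lk.
  rewrite lk sumr_const card_ord; over.
rewrite prodr_const /freq card_ffun card_ord.
have -> : #|{: 'I_p * 'I_n}| = #|predC1 k|.+1.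
  by rewrite cardC1 prednK //; apply/card_gt0P; exists k.
rewrite natrX exprS.
by rewrite -mulf_div divff ?mulr1 // expf_neq0 // pnatr_eq0 -lt0n.
Qed.

(** Translation by [w] is injective on the matrices that stay in the box; any other has one of its p
    n entries among the at most W values that overflow. *)
Lemma freq_shift (W : nat) (w : 'M[int]_(p, n)) (P : 'M[int]_(p, n) -> bool) :
  inbox W w ->
  freq (fun H : box => P (box_point H + w)) <=
  freq (fun H : box => P (box_point H)) + (p * n * W)%:R / M%:R.
Proof.
move=> wW; pose bad (H : box) := [exists k, overflows (w k.1 k.2) (H k)].
apply: (@le_trans _ _
    (freq (fun H => ~~ bad H && P (box_point H + w)) + freq bad)).
  apply: le_trans (freqU _ _); apply: sub_freq => H ->.
  by rewrite andbT orNb.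
apply: lerD; last first.
  apply: le_trans (freq_exists _) _.
  apply: (@le_trans _ _ (\sum_(k : 'I_p * 'I_n) W%:R / M%:R)).
    apply: ler_sum => k _; rewrite freq_coord /freq card_ord.
    rewrite ler_wpM2r ?invr_ge0 //.
    rewrite -natr_sum ler_nat (leq_trans _ (wW k.1 k.2)) //.
    rewrite (leq_trans _ (card_overflows _)) //.
    by rewrite -sum1_card [leqRHS]big_mkcond.
  rewrite sumr_const card_prod !card_ord natrM -mulrA.
  by rewrite -[X in X <= _]mulr_natl.
rewrite /freq ler_wpM2r ?invr_ge0 // -!natr_sum ler_nat.
(* When [bad H] fails, the default [H k] of [insubd] is not reached and [f H] is the true
   translate. *)
pose f (H : box) : box :=
  [ffun k => insubd (H k) (absz ((H k : nat)%:Z + w k.1 k.2))].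
have fE H : ~~ bad H -> box_point (f H) = box_point H + w.
  rewrite negb_exists => /forallP ok; apply/matrixP => i j; rewrite !mxE ffunE.
  have := ok (i, j); rewrite negbK /= => /andP[ge0 ltM].
  by rewrite insubdK ?gez0_abs // -topredE /=; lia.
have cardQ (Q : box -> bool) : (\sum_H Q H = #|[pred H | Q H]|)%N.
  rewrite -sum1_card [RHS]big_mkcond.
  by apply: eq_bigr => H _; rewrite inE; case: (Q H).
rewrite !cardQ.
rewrite -(card_in_imset (f := f)) => [|H K].
  apply: subset_leq_card; apply/fintype.subsetP => _ /imsetP[H + ->].
  by rewrite !inE => /andP[/fE ->].
rewrite !inE => /andP[/fE HE _] /andP[/fE KE _] fHK.
have : box_point H = box_point K by apply: (addIr w); rewrite -HE -KE fHK.
move=> /matrixP HK; apply/ffunP => -[i j]; have := HK i j; rewrite !mxE => -[].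
exact: val_inj.
Qed.

End Box.
End Frequency.

Lemma inbox_leq n p X Y (x : 'M[int]_(p, n)) :
  (X <= Y)%N -> inbox X x -> inbox Y x.
Proof. by move=> XY xX i j; apply: leq_trans XY. Qed.

Lemma inbox_add n p X Y (x y : 'M[int]_(p, n)) :
  inbox X x -> inbox Y y -> inbox (X + Y) (x + y).
Proof.
move=> xX yY i j; rewrite mxE; move: (xX i j) (yY i j).
by move: (x i j) (y i j) => a b; lia.
Qed.

Lemma inbox_scale n p X (t : nat) (x : 'M[int]_(p, n)) :
  inbox X x -> inbox (t * X) (t%:Z *: x).
Proof. by move=> xX i j; rewrite mxE abszM leq_mul2l xX orbT. Qed.

(** * Self-correction along random two-dimensional sublattices *)

Section SelfCorrection.
Variables (R : realType) (n d : nat).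

Notation I := 'I_d.+1.

(* A primitive vector: the point of parameter [1 + (i + 1) k] on the line
   through [(i + 1, 0)] of direction [(0, 1)]. *)
Definition cvec (s : I * I) : 'rV[int]_2 :=
  \row_j if j == ord0 then s.1.+1%:Z else (1 + s.1.+1 * s.2)%N%:Z.

Definition cinv (s : I * I) : 'cV[int]_2 :=
  \col_j if j == ord0 then - (s.2 : nat)%:Z else 1.

(** Bezout relation: with a = s.1 + 1 and k = s.2, one has - k a + (1 + a k) = 1. *)
Lemma cvecK s : cvec s *m cinv s = 1%:M.
Proof.
apply/matrixP => i j; rewrite !mxE !big_ord_recl big_ord0 !mxE /= !ord1 eqxx.
by rewrite mulrN mulr1 addr0 PoszD PoszM addrCA addNr addr0.
Qed.

Lemma cvecE s (H : 'M[int]_(2, n)) : cvec s *m H =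
  s.1.+1%:Z *: row ord0 H + (1 + s.1.+1 * s.2)%N%:Z *: row (lift ord0 ord0) H.
Proof.
by apply/rowP => j; rewrite !mxE !big_ord_recl big_ord0 !mxE /= addr0.
Qed.

(** Outer coefficient of the node s.1 + 1 on the first line, times the inner coefficient of the
    parameter 1 + (s.1 + 1) s.2 on the second. *)
Definition cweight (s : I * I) : R :=
  alpha R s.1 * weight0 (fun t => (1 + s.1.+1 * t)%:R) s.2.

Definition corrected (F : 'rV[int]_n -> R) x (H : 'M[int]_(2, n)) : R :=
  \sum_s cweight s * F (x + cvec s *m H).

(** What acceptance uses of a polynomial of degree at most d, expressed on Z^n because the tested
    function is constrained on the lattice only. *)
Definition poly_on_lines (F : 'rV[int]_n -> R) : Prop :=
  forall x y, exists2 q : {poly R}, (size q <= d.+1)%N &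
    forall t : int, F (x + t *: y) = q.[t%:~R].

Variable F : 'rV[int]_n -> R.

Lemma poly_line_interp x y : poly_on_lines F -> F x = line_interp d F x y.
Proof.
move=> /(_ x y)[q sq qF]; rewrite -[x in LHS]addr0 -[0 in LHS](scale0r y) qF.
rewrite (alphaP _ 1 sq); apply: eq_bigr => i _.
by rewrite qF add0r mul1r.
Qed.

Lemma poly_corrected x H : poly_on_lines F -> F x = corrected F x H.
Proof.
move=> Fp; rewrite (poly_line_interp x (row ord0 H) Fp) /corrected.
rewrite -(pair_bigA _ (fun i k => cweight (i, k) * F (x + cvec (i, k) *m H))).
apply: eq_bigr => i _ /=.
have [q sq qF] := Fp (x + i.+1%:Z *: row ord0 H) (row (lift ord0 ord0) H).
have s_inj : injective (fun t : nat => (1 + i.+1 * t)%:R : R).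
  by move=> t u /eqP; rewrite eqr_nat eqn_add2l eqn_mul2l /= => /eqP.
have := weight0P s_inj sq; rewrite -(qF 0) scale0r addr0 => ->.
rewrite mulr_sumr; apply: eq_bigr => k _.
by rewrite mulrA cvecE addrA qF.
Qed.

Variables (M N : nat).
Hypotheses (M_gt0 : (0 < M)%N) (N_gt0 : (0 < N)%N).

Notation box M := {ffun 'I_2 * 'I_n -> 'I_M}.

Definition badA (t : (I * I) * (box M * box M)) : bool :=
  F (cvec t.1 *m box_point t.2.1) !=
  corrected F (cvec t.1 *m box_point t.2.1) (box_point t.2.2).

Definition badB (t : (I * I) * (box M * box N)) : bool :=
  F (cvec t.1 *m box_point t.2.1) !=
  line_interp d F (cvec t.1 *m box_point t.2.1) (cvec t.1 *m box_point t.2.2).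

Variables (X : nat) (th : R).
(** Radius containing x + t y for x, y of radius X and t at most d + 1. *)
Notation W := (d.+2 * X)%N.
Hypotheses (X_gt0 : (0 < X)%N) (dX : (d <= X)%N) (ndX : (n * d * d <= X)%N).
(** Losses in [freq_shift] for the three translations used: H by u x, H by t K with t at most d + 1,
    and K by u y, where u is [cinv s]. *)
Hypotheses (thW : (2 * n * (d.+1 * W))%:R / M%:R <= th)
           (thN : (2 * n * (d.+1 * N))%:R / M%:R <= th)
           (thX : (2 * n * (d.+1 * X))%:R / N%:R <= th).

Lemma inbox_cinv s p (Y : nat) (x : 'M[int]_(1, p)) :
  inbox Y x -> inbox (d.+1 * Y) (cinv s *m x).
Proof.
move=> xY i j; rewrite !mxE big_ord_recl big_ord0 addr0 !mxE abszM leq_mul //.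
by have := ltn_ord s.2; case: eqP => _; lia.
Qed.

Lemma cvec_shift s x (H : 'M[int]_(2, n)) :
  cvec s *m (H + cinv s *m x) = x + cvec s *m H.
Proof. by rewrite mulmxDr mulmxA cvecK mul1mx addrC. Qed.

(** With the second matrix frozen, translating the first by [cinv s *m x] turns c H into x + c H, by
    [cvec_shift]. *)
Lemma freq_corrected_shift s x : inbox W x ->
  freq R (fun HH : box M * box M =>
    F (x + cvec s *m box_point HH.1) !=
    corrected F (x + cvec s *m box_point HH.1) (box_point HH.2))
  <= freq R (fun HH => badA (s, HH)) + th.
Proof.
move=> xW; rewrite freq_swap [X in _ <= X + _]freq_swap.
apply: freq_fibers => [|H']; first exact: card_box_gt0.
pose P G := F (cvec s *m G) != corrected F (cvec s *m G) (box_point H').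
have := freq_shift R M_gt0 P (inbox_cinv s xW).
rewrite (eq_freq R (Q := fun H => F (x + cvec s *m box_point H) !=
   corrected F (x + cvec s *m box_point H) (box_point H'))) => [|H]; last first.
  by rewrite /P cvec_shift.
by move=> /le_trans; apply; rewrite lerD2l.
Qed.

(** A union bound over [s], doubled because both orders of the pair of matrices have to be good. *)
Definition kappa : R := 2 * (\sum_s (freq R (fun HH => badA (s, HH)) + th)).

(** If each node x + c H may be replaced by its correction along H', the correction of x along H
    becomes a double sum symmetric in H and H'. *)
Lemma freq_corrected_disagree x : inbox W x ->
  freq R (fun HH : box M * box M =>
    corrected F x (box_point HH.1) != corrected F x (box_point HH.2)) <= kappa.
Proof.
move=> xW.
pose bad s (HH : box M * box M) := F (x + cvec s *m box_point HH.1) !=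
    corrected F (x + cvec s *m box_point HH.1) (box_point HH.2).
pose B HH := [exists s, bad s HH].
have freqB : freq R B <= \sum_s (freq R (fun HH => badA (s, HH)) + th).
  apply: le_trans (freq_exists _ _) _; apply: ler_sum => s _.
  exact: freq_corrected_shift.
have expand HH : ~~ B HH -> corrected F x (box_point HH.1) =
    \sum_s \sum_s' cweight s * cweight s' *
      F (x + cvec s *m box_point HH.1 + cvec s' *m box_point HH.2).
  rewrite negb_exists => /forallP ok; apply: eq_bigr => s _.
  have /eqP -> := negbNE (ok s); rewrite mulr_sumr.
  by apply: eq_bigr => s' _; rewrite mulrA.
apply: (@le_trans _ _ (freq R (fun HH => B HH || B (HH.2, HH.1)))).
  apply: sub_freq => HH; apply: contraR; rewrite negb_or => /andP[B1 B2].
  rewrite expand // (expand _ B2) exchange_big /=; apply/eqP.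
  apply: eq_bigr => s _; apply: eq_bigr => s' _.
  by rewrite [cweight s' * _]mulrC addrAC.
apply: le_trans (freqU _ _ _) _; rewrite -(freq_swap R B) /kappa.
by rewrite -mulr2n -[X in X <= _]mulr_natl ler_wpM2l.
Qed.

(** Fix one matrix that does no worse than average and take its correction as [v]. *)
Lemma corrected_plurality x : inbox W x ->
  exists v, freq R (fun H : box M => corrected F x (box_point H) != v) <= kappa.
Proof.
move=> xW; have := freq_corrected_disagree xW; rewrite freq_swap => le.
have [H' leH'] := freq_exists_fiber R (fun HH : box M * box M =>
  corrected F x (box_point HH.2) != corrected F x (box_point HH.1))
  (card_box_gt0 2 n M_gt0).
by exists (corrected F x (box_point H')); apply: le_trans leH' le.
Qed.

Lemma freq_line_shift s x y : inbox X x -> inbox X y ->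
  freq R (fun HK : box M * box N =>
    F (x + cvec s *m box_point HK.1) !=
    line_interp d F (x + cvec s *m box_point HK.1)
      (y + cvec s *m box_point HK.2))
  <= freq R (fun HK => badB (s, HK)) + th + th.
Proof.
move=> xX yX.
pose P G v := F (cvec s *m G) != line_interp d F (cvec s *m G) v.
(* First H is translated with K frozen, then K with H frozen. *)
apply: (@le_trans _ _ (freq R (fun HK : box M * box N =>
    P (box_point HK.1) (y + cvec s *m box_point HK.2)) + th)).
  rewrite freq_swap [X in _ <= X + _]freq_swap.
  apply: freq_fibers => [|K]; first exact: card_box_gt0.
  have xW : inbox W x by apply: inbox_leq xX; rewrite leq_pmull.
  have := freq_shift R M_gt0 (fun G => P G (y + cvec s *m box_point K))
    (inbox_cinv s xW).
  rewrite (eq_freq R (Q := fun H => F (x + cvec s *m box_point H) !=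
    line_interp d F (x + cvec s *m box_point H) (y + cvec s *m box_point K))).
    by move=> /le_trans; apply; rewrite lerD2l.
  by move=> H; rewrite /P !cvec_shift.
rewrite lerD2r; apply: freq_fibers => [|H]; first exact: card_box_gt0.
have := freq_shift R N_gt0 (fun L => P (box_point H) (cvec s *m L))
  (inbox_cinv s yX).
rewrite (eq_freq R (Q := fun K => P (box_point H) (y + cvec s *m box_point K))).
  by move=> /le_trans; apply; rewrite lerD2l.
by move=> K; rewrite cvec_shift.
Qed.

(** For each K, passing from H to H + t K is a translation by a matrix with entries at most (d + 1)
    N, whose loss [thN] bounds. *)
Lemma freq_direction_shift (t : 'I_d.+2) x (v : R) :
  freq R (fun HK : box M * box N =>
    corrected F x (box_point HK.1 + (t : nat)%:Z *: box_point HK.2) != v)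
  <= freq R (fun H : box M => corrected F x (box_point H) != v) + th.
Proof.
rewrite -[X in _ <= X + _](freq_fst _ _ (card_box_gt0 2 n N_gt0)).
rewrite freq_swap [X in _ <= X + _]freq_swap.
apply: freq_fibers => [|K]; first exact: card_box_gt0.
have KN : inbox (d.+1 * N) ((t : nat)%:Z *: box_point K).
  move=> i j; rewrite !mxE abszM leq_mul //; first by rewrite -ltnS ltn_ord.
  exact: ltnW (ltn_ord _).
have := freq_shift R M_gt0 (fun G => corrected F x G != v) KN.
by move=> /le_trans; apply; rewrite lerD2l.
Qed.

Hypotheses
  (kappa_small : d.+2%:R * (kappa + th) +
     \sum_s (freq R (fun HK => badB (s, HK)) + th + th) < 1)
  (kappa_half : kappa <= 1 / 2).

(** By the union bound [kappa_small], some H and K are such that the correction of x + t y along H +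
    t K is [g (x + t y)] for t = 0, ..., d + 1, and F obeys the line identity at every x + c H in
    direction y + c K. As x + t y + c (H + t K) = (x + c H) + t (y + c K), summing these identities
    with [cweight] gives the one for [g]. *)
Lemma corrected_line_identity (g : 'rV[int]_n -> R) :
  (forall x, inbox W x ->
    freq R (fun H : box M => corrected F x (box_point H) != g x) <= kappa) ->
  forall x y, inbox X x -> inbox X y -> g x = line_interp d g x y.
Proof.
move=> gP x y xX yX.
pose bad1 (t : 'I_d.+2) (HK : box M * box N) :=
  corrected F (x + (t : nat)%:Z *: y)
    (box_point HK.1 + (t : nat)%:Z *: box_point HK.2) !=
  g (x + (t : nat)%:Z *: y).
pose bad2 s (HK : box M * box N) := F (x + cvec s *m box_point HK.1) !=
  line_interp d F (x + cvec s *m box_point HK.1) (y + cvec s *m box_point HK.2).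
have : freq R (fun HK => [exists t, bad1 t HK] || [exists s, bad2 s HK]) < 1.
  apply: le_lt_trans kappa_small; apply: le_trans (freqU _ _ _) _; apply: lerD.
    apply: le_trans (freq_exists _ _) _.
    rewrite mulr_natl -[X in _ *+ X](card_ord d.+2) -sumr_const.
    apply: ler_sum => t _; apply: le_trans (freq_direction_shift _ _ _) _.
    rewrite lerD2r gP //; apply: (@inbox_leq _ _ (X + d.+1 * X)) => //.
    apply: inbox_add => //; apply: (@inbox_leq _ _ (t * X)).
      by rewrite leq_mul // -ltnS ltn_ord.
    exact: inbox_scale.
  apply: le_trans (freq_exists _ _) _; apply: ler_sum => s _.
  exact: freq_line_shift.
move=> /freq_lt1[|[H K]]; first by rewrite card_prod muln_gt0 !card_box_gt0.
rewrite negb_or !negb_exists => /andP[/forallP ok1 /forallP ok2].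
have /eqP := negbNE (ok1 ord0); rewrite !scale0r !addr0 => <-.
transitivity (\sum_s cweight s *
    line_interp d F (x + cvec s *m box_point H) (y + cvec s *m box_point K)).
  by apply: eq_bigr => s _; have /eqP -> := negbNE (ok2 s).
under eq_bigr => s _ do rewrite mulr_sumr.
rewrite exchange_big; apply: eq_bigr => i _.
have /eqP /= := negbNE (ok1 (lift ord0 i)); rewrite /bump /= => <-.
rewrite mulr_sumr; apply: eq_bigr => s _; rewrite mulrCA; congr (_ * (_ * F _)).
by rewrite mulmxDr -scalemxAr scalerDr addrACA.
Qed.

(** The plurality values form one function, with default 0 outside radius W. It obeys the line
    identity, so its tensor coefficients of weight above d vanish. *)
Lemma self_correction :
  exists2 a : {ffun 'I_n -> I} -> R,
    (forall e, (d < weight e)%N -> a e = 0) &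
    forall x, inbox X x ->
      freq R (fun H : box M => corrected F x (box_point H) !=
        \sum_e a e * \prod_i (x ord0 i)%:~R ^+ e i) <= 1 / 2.
Proof.
have /choice[g gP] : forall x, exists v, inbox W x ->
    freq R (fun H : box M => corrected F x (box_point H) != v) <= kappa.
  move=> x; have [xW|xW] := pselect (inbox W x); last by exists 0.
  by have [v] := corrected_plurality xW; exists v.
have g_lines := corrected_line_identity gP.
exists (tensor_coef g) => [e|x xX].
  exact: (tensor_coef_eq0 X_gt0 dX ndX g_lines).
rewrite -tensor_coefP -(tensor_interpP X_gt0 dX ndX g_lines) //.
apply: le_trans kappa_half; apply: gP; apply: inbox_leq xX.
by rewrite leq_pmull.
Qed.

End SelfCorrection.

(** * Rounds of random checks: rejection, acceptance and queries *)

Section Algorithms.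
Variables (R : realType) (n : nat).
Notation point := 'rV[R]_n.
Notation algo := (algorithm R n).

Lemma esum_mulr_ge (T : choiceType) (A : set T) (a : T -> R) (c : R) :
  0 <= c -> (forall x, 0 <= a x) ->
  (c%:E * (\esum_(x in A) (a x)%:E) <= \esum_(x in A) (a x * c)%:E)%E.
Proof.
rewrite le_eqVlt => /predU1P[<-|c0] a0.
  by rewrite mul0e esum_ge0 // => x _; rewrite mulr0.
rewrite -lee_pdivlMl //; apply: ge_ereal_sup => _ [X [finX XA] <-].
rewrite lee_pdivlMl // ge0_mule_fsumr; last by move=> x; rewrite lee_fin.
apply: ereal_sup_ubound; exists X => //; apply: eq_fsbigr => x _.
by rewrite EFinM muleC.
Qed.

Lemma esum_ord (N : nat) (a : nat -> \bar R) :
  (forall i, (i < N)%N -> 0 <= a i)%E -> (forall i, (N <= i)%N -> a i = 0%E) ->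
  (\esum_(i in [set: nat]) a i = \sum_(i < N) a i)%E.
Proof.
move=> a0 aN; rewrite fsbig_ord -esum_fset; last 2 first.
- exact: finite_II.
- by move=> i; rewrite inE => /a0.
rewrite [RHS]esum_mkcond; apply: eq_esum => i _.
by case: ifPn => //; rewrite notin_setE => /negP; rewrite -leqNgt => /aN.
Qed.

Section Uniform.
Variables (N : nat) (N_gt0 : (0 < N)%N).

Definition uniform_pmf (i : nat) : R := if (i < N)%N then N%:R^-1 else 0.

Lemma uniform_pmf_ge0 i : 0 <= uniform_pmf i.
Proof. by rewrite /uniform_pmf; case: ifP => // _; rewrite invr_ge0. Qed.

Lemma uniform_pmf_sum1 : (\esum_(i in [set: nat]) (uniform_pmf i)%:E = 1)%E.
Proof.
rewrite (@esum_ord N) => [|i _|i iN].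
- under eq_bigr => i _ do rewrite /uniform_pmf ltn_ord.
  rewrite sumEFin sumr_const card_ord -[X in X%:E]mulr_natr mulVf //.
  by rewrite pnatr_eq0 -lt0n.
- by rewrite lee_fin uniform_pmf_ge0.
- by rewrite /uniform_pmf ltnNge iN.
Qed.

Definition uniform : discrete_distribution R nat :=
  DiscreteDistribution uniform_pmf_ge0 uniform_pmf_sum1.

End Uniform.

(** [Draw] works over [nat], so an element is drawn through its index; the default [Output true]
    sits at indices of probability 0. *)
Definition draw_from (T : finType) (T_gt0 : (0 < #|T|)%N)
    (k : T -> algo) : algo :=
  Draw (uniform T_gt0) (fun i =>
    if insub i is Some o then k (enum_val (o : 'I_#|T|)) else Output _ _ true).

(** [acc] holds the weighted sum of the answers so far. The decision comes after the whole list, so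
    a check always costs [size l] queries. *)
Fixpoint check (l : seq (R * point)) (acc : R) (k : algo) : algo :=
  if l is (w, x) :: l' then Query x (fun v => check l' (acc + w * v) k)
  else if acc == 0 then k else Output _ _ false.

Definition check_round (T : finType) (T_gt0 : (0 < #|T|)%N)
    (l : T -> seq (R * point)) (k : algo) : algo :=
  draw_from T_gt0 (fun t => check (l t) 0 k).

Definition sample_round (T : finType) (T_gt0 : (0 < #|T|)%N)
    (l : point -> T -> seq (R * point)) (k : algo) : algo :=
  Sample (fun x => check_round T_gt0 (l x) k).

Section Semantics.
Variables (f : point -> R) (D : discrete_distribution R point).

Definition residual (l : seq (R * point)) : R := \sum_(wx <- l) wx.1 * f wx.2.

Lemma outcome_prob_ge0 t b : (0 <= outcome_prob f D t b)%E.
Proof.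
elim: t => [b'|x k IH|k IH|p k IH] /=; first by rewrite lee_fin.
- exact: IH.
- by apply: esum_ge0 => x _; rewrite mule_ge0 ?IH ?lee_fin ?Defs.pmf_ge0.
- by apply: esum_ge0 => x _; rewrite mule_ge0 ?IH ?lee_fin ?Defs.pmf_ge0.
Qed.

Lemma outcome_check l acc k b : outcome_prob f D (check l acc k) b =
  if acc + residual l == 0 then outcome_prob f D k b
  else ((false == b)%:R%:E)%E.
Proof.
elim: l acc => [|[w x] l IH] acc /=.
  by rewrite /residual big_nil addr0; case: ifP.
by rewrite IH /residual big_cons addrA.
Qed.

Lemma outcome_draw_from (T : finType) (T_gt0 : (0 < #|T|)%N) (k : T -> algo) b :
  (outcome_prob f D (draw_from T_gt0 k) b =
   \sum_(t : T) (#|T|%:R^-1)%:E * outcome_prob f D (k t) b)%E.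
Proof.
rewrite /= (@esum_ord #|T|) => [|i iT|i iT].
- rewrite [RHS](reindex (@enum_val T predT)) /=; last first.
    by exists enum_rank => t _; rewrite ?enum_valK ?enum_rankK.
  apply: eq_bigr => i _; rewrite /uniform_pmf ltn_ord.
  rewrite insubT ?ltn_ord // => ltiT.
  congr (_ * outcome_prob _ _ (k (enum_val _)) _)%E.
  exact: val_inj.
- by rewrite mule_ge0 ?outcome_prob_ge0 // lee_fin uniform_pmf_ge0.
- by rewrite /uniform_pmf ltnNge iT mul0e.
Qed.

Definition rejects (t : algo) (rho : R) : Prop :=
  (rho%:E <= outcome_prob f D t false)%E.

Definition accepts (t : algo) : Prop := outcome_prob f D t true = 1%E.

Lemma rejects0 t : rejects t 0.
Proof. exact: outcome_prob_ge0. Qed.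

Lemma le_rejects t rho rho' : rho <= rho' -> rejects t rho' -> rejects t rho.
Proof. by move=> le; apply: le_trans; rewrite lee_fin. Qed.

(** Surviving means passing the check and then, independently, surviving [k]; the product form of
    the bound is what iterates. *)
Lemma rejects_check_round (T : finType) (T_gt0 : (0 < #|T|)%N) l k rho a :
  0 <= rho <= 1 -> a <= freq R (fun t => residual (l t) != 0) ->
  rejects k rho -> rejects (check_round T_gt0 l k) (1 - (1 - a) * (1 - rho)).
Proof.
move=> /andP[rho0 rho1] ale rk; rewrite /rejects outcome_draw_from.
apply: (@le_trans _ _ (\sum_(t : T) (#|T|%:R^-1 *
    (rho + (1 - rho) * (residual (l t) != 0)%:R))%:E)%E).
  rewrite sumEFin lee_fin -mulr_sumr.
  have -> : #|T|%:R^-1 * (\sum_t (rho + (1 - rho) * (residual (l t) != 0)%:R)) =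
      rho + (1 - rho) * freq R (fun t => residual (l t) != 0).
    rewrite big_split /= sumr_const -mulr_sumr -[X in _ * (X + _)]mulr_natr.
    by rewrite mulrC mulrDl mulfK ?pnatr_eq0 -?lt0n // mulrA.
  have := ler_wpM2l (_ : 0 <= 1 - rho) ale; rewrite subr_ge0 => /(_ rho1).
  by lra.
apply: lee_sum => t _; rewrite EFinM lee_wpmul2l ?lee_fin ?invr_ge0 //.
rewrite outcome_check add0r; case: eqP => _ /=.
  by rewrite mulr0 addr0.
by rewrite mulr1 addrC subrK.
Qed.

(** The sample lies in [A] with probability at least q, and there the check fails with rate at least
    a, so the round rejects with rate at least q a. *)
Lemma rejects_sample_round (T : finType) (T_gt0 : (0 < #|T|)%N) l k rho a q
    (A : set point) :
  0 <= rho <= 1 -> 0 <= a -> (q%:E <= Pr D A)%E ->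
  (forall x, A x -> a <= freq R (fun t => residual (l x t) != 0)) ->
  rejects k rho ->
  rejects (sample_round T_gt0 l k) (1 - (1 - q * a) * (1 - rho)).
Proof.
move=> /[dup] rho01 /andP[rho0 rho1] a0 qA aA rk; rewrite /rejects.
have b0 : 0 <= (1 - rho) * a by rewrite mulr_ge0 ?subr_ge0.
apply: (@le_trans _ _ (\esum_(x in [set: point]) ((D x * rho)%:E +
    if x \in A then (D x * ((1 - rho) * a))%:E else 0))%E).
  rewrite esumD => [|x _|x _]; last 2 first.
  - by rewrite lee_fin mulr_ge0 ?Defs.pmf_ge0.
  - by case: ifP; rewrite // lee_fin mulr_ge0 ?Defs.pmf_ge0.
  rewrite -esum_mkcond.
  have -> : 1 - (1 - q * a) * (1 - rho) = rho * 1 + ((1 - rho) * a) * q by ring.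
  rewrite EFinD leeD //.
    rewrite EFinM -(Defs.pmf_sum1 D).
    by apply: esum_mulr_ge => //; exact: Defs.pmf_ge0.
  apply: (@le_trans _ _ (((1 - rho) * a)%:E * Pr D A)%E).
    by rewrite EFinM lee_wpmul2l ?lee_fin.
  by apply: esum_mulr_ge => //; exact: Defs.pmf_ge0.
apply: le_esum => x _.
(* Used at rate 0 for a sample outside [A]: the continuation alone rejects with probability
   [rho]. *)
have := rejects_check_round T_gt0 (l := l x) rho01 (freq_ge0 R _) rk.
rewrite subr0 mul1r subKr => r0.
case: ifPn => [|_]; last first.
  by rewrite adde0 EFinM lee_wpmul2l ?lee_fin ?Defs.pmf_ge0.
rewrite inE => /aA aAx; rewrite -EFinD -mulrDr EFinM.
rewrite lee_wpmul2l ?lee_fin ?Defs.pmf_ge0 //.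
apply: le_trans (rejects_check_round T_gt0 rho01 aAx rk).
by rewrite lee_fin; lra.
Qed.

(** As (1 - a)^m (1 + m a) <= 1, the condition m a >= 2 leaves a chance of at most 1/3 to survive m
    rounds. *)
Lemma rejects_iter (round : algo -> algo) (a : R) (m : nat) (k : algo) :
  0 <= a <= 1 -> 2 <= m%:R * a ->
  (forall t rho, 0 <= rho <= 1 -> rejects t rho ->
     rejects (round t) (1 - (1 - a) * (1 - rho))) ->
  rejects (iter m round k) (2 / 3).
Proof.
move=> /andP[a0 a1] ma rround.
have pow_le : (1 - a) ^+ m * (1 + m%:R * a) <= 1.
  elim: m {ma} => [|m IH]; first by rewrite mul1r mul0r addr0.
  apply: le_trans IH; rewrite exprSr -mulrA ler_wpM2l ?exprn_ge0 ?subr_ge0 //.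
  rewrite -addn1 natrD; have m0 := ler0n R m; nra.
have pow_ge0 j : 0 <= (1 - a) ^+ j by rewrite exprn_ge0 ?subr_ge0.
have pow_le1 j : (1 - a) ^+ j <= 1.
  by rewrite exprn_ile1 ?subr_ge0 // lerBlDl lerDr.
apply: (@le_rejects _ _ (1 - (1 - a) ^+ m)).
  have := pow_ge0 m; nra.
elim: m {ma pow_le} => [|m IH]; first by rewrite expr0 subrr; exact: rejects0.
rewrite /= exprS -[X in (1 - a) * X](subKr 1); apply: rround => //.
by rewrite subr_ge0 lerBlDl lerDr pow_le1 pow_ge0.
Qed.

Lemma accepts_check_round (T : finType) (T_gt0 : (0 < #|T|)%N) l k :
  (forall t, residual (l t) = 0) -> accepts k ->
  accepts (check_round T_gt0 l k).
Proof.
move=> l0 ak; rewrite /accepts outcome_draw_from.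
under eq_bigr => t _ do rewrite outcome_check add0r l0 eqxx ak mule1.
rewrite sumEFin sumr_const -[X in X%:E]mulr_natr mulVf //.
by rewrite pnatr_eq0 -lt0n.
Qed.

Lemma accepts_sample_round (T : finType) (T_gt0 : (0 < #|T|)%N) l k :
  (forall x, D x != 0 -> forall t, residual (l x t) = 0) -> accepts k ->
  accepts (sample_round T_gt0 l k).
Proof.
move=> l0 ak; rewrite /accepts -[RHS](Defs.pmf_sum1 D); apply: eq_esum => x _.
have [->|Dx] := eqVneq (D x) 0; first by rewrite mul0e.
rewrite -[RHS]mule1; congr (_ * _)%E.
exact: (accepts_check_round T_gt0 (l0 x Dx) ak).
Qed.

Lemma accepts_iter (round : algo -> algo) (m : nat) (k : algo) :
  (forall t, accepts t -> accepts (round t)) -> accepts k ->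
  accepts (iter m round k).
Proof. by move=> ra ak; elim: m => //= m; exact: ra. Qed.

(** The two query requirements are joined so as to be proved together, round by round. *)
Definition within (A : set point) (t : algo) (m : nat) : Prop :=
  forall s, execution f D t s -> (size s <= m)%N /\ forall x, x \in s -> A x.

Lemma within_Output A b m : within A (Output _ _ b) m.
Proof. by move=> s E; inversion E; subst; split. Qed.

Lemma within_check A l acc k m :
  (forall wx, wx \in l -> A wx.2) -> within A k m ->
  within A (check l acc k) (size l + m).
Proof.
move=> lA km; elim: l lA acc => [|[w x] l IH] lA acc /=.
  by case: ifP => _ //; exact: within_Output.
move=> s E; inversion E as [|x' k' s' E'| |]; subst; clear E.
have lA' wx : wx \in l -> A wx.2 by move=> wxl; apply: lA; rewrite inE wxl orbT.
have [sm sA] := IH lA' _ _ E'.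
split=> // y; rewrite inE => /predU1P[->|/sA//].
by apply: (lA (w, x)); rewrite inE eqxx.
Qed.

Lemma within_check_round A (T : finType) (T_gt0 : (0 < #|T|)%N) l k m c :
  (forall t, size (l t) = c) -> (forall t wx, wx \in l t -> A wx.2) ->
  within A k m -> within A (check_round T_gt0 l k) (c + m).
Proof.
move=> lc lA km s E; inversion E as [| | |p k' i s' pi Ei]; subst; clear E.
move: Ei; case: insubP => [j _ _|iT].
  by rewrite -(lc (enum_val j)); apply: within_check => // wx; apply: lA.
by move: pi; rewrite /= /uniform_pmf (negPf iT) ltxx.
Qed.

Lemma within_sample_round A (T : finType) (T_gt0 : (0 < #|T|)%N) l k m c :
  (forall x t, size (l x t) = c) ->
  (forall x, 0 < D x -> forall t wx, wx \in l x t -> A wx.2) ->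
  within A k m -> within A (sample_round T_gt0 l k) (c + m).
Proof.
move=> lc lA km s E; inversion E as [| |k' x s' Dx Ex|]; subst; clear E.
exact: (within_check_round (lc x) (lA x Dx) km) Ex.
Qed.

Lemma within_iter A (round : algo -> algo) c m k j :
  (forall t i, within A t i -> within A (round t) (c + i)) ->
  within A k j -> within A (iter m round k) (m * c + j).
Proof.
move=> rA kj; elim: m => [|m IH] //=.
by rewrite mulSn -addnA; exact: rA.
Qed.

End Semantics.
End Algorithms.

(** * Multivariate polynomials: restriction to lines, assembly from coefficients *)

Section Polynomials.
Variables (R : realType) (n : nat).

Lemma size_prod_expr_le (F : 'I_n -> {poly R}) (m : 'I_n -> nat) :
  (forall i, (size (F i) <= 2)%N) ->
  (size (\prod_i F i ^+ m i)%R <= (\sum_i m i).+1)%N.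
Proof.
move=> F2; elim/big_ind2 : _ => [|p a q b pa qb|i _].
  by rewrite size_poly1.
  apply: leq_trans (size_polyMleq _ _) _.
  by move: (leq_add pa qb); rewrite addSn addnS; case: (_ + _)%N.
apply: leq_trans (size_poly_exp_leq _ _) _.
rewrite ltnS -[leqRHS]mul1n leq_mul //.
by have := F2 i; case: size.
Qed.

(** On the line, a monomial becomes a product of as many affine polynomials in t as its total
    degree. *)
Lemma peval_line d (p : mpoly.mpoly n R) (x y : 'rV[R]_n) : deg_le d p ->
  exists2 q : {poly R}, (size q <= d.+1)%N &
    forall t : R, peval p (x + t *: y) = q.[t].
Proof.
move=> dp; pose F i : {poly R} := (x ord0 i)%:P + y ord0 i *: 'X.
exists (\sum_(m <- mpoly.msupp p) mpoly.mcoeff m p *: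
    \prod_i F i ^+ (m : mpoly.multinom n) i) => [|t].
  rewrite big_seq_cond; elim/big_ind : _ => [|q1 q2 s1 s2|m].
  - by rewrite size_poly0.
  - by rewrite (leq_trans (size_polyD _ _)) // geq_max s1 s2.
  rewrite andbT => mp; apply: leq_trans (size_scale_leq _ _) _.
  apply: leq_trans (size_prod_expr_le _ _) _ => [i|].
    rewrite (leq_trans (size_polyD _ _)) // geq_max.
    rewrite (leq_trans (size_polyC_leq1 _)) //=.
    by rewrite (leq_trans (size_scale_leq _ _)) ?size_polyX.
  rewrite -mpoly.mdegE; apply: leq_trans dp; exact: mpoly.msize_mdeg_lt.
rewrite /peval mpoly.mevalE horner_sum; apply: eq_bigr => m _.
rewrite hornerZ horner_prod; congr (_ * _); apply: eq_bigr => i _.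
by rewrite horner_exp /F !hornerE !mxE [t * _]mulrC.
Qed.

Definition grid_mpoly d (a : {ffun 'I_n -> 'I_d.+1} -> R) : mpoly.mpoly n R :=
  \sum_e a e *: mpoly.mpolyX R (mpoly.Multinom [tuple (e i : nat) | i < n]).

Lemma peval_grid_mpoly d (a : {ffun 'I_n -> 'I_d.+1} -> R) x :
  peval (grid_mpoly a) x = \sum_e a e * \prod_i x ord0 i ^+ e i.
Proof.
rewrite /peval raddf_sum; apply: eq_bigr => e _ /=.
rewrite mpoly.mevalZ mpoly.mevalX; congr (_ * _); apply: eq_bigr => i _.
by rewrite mpoly.multinomE tnth_mktuple.
Qed.

Lemma deg_le_grid_mpoly d (a : {ffun 'I_n -> 'I_d.+1} -> R) :
  (forall e, (d < weight e)%N -> a e = 0) -> deg_le d (grid_mpoly a).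
Proof.
move=> a0; rewrite /deg_le /grid_mpoly; elim/big_ind : _ => [|p q dp dq|e _].
- by rewrite mpoly.msize0.
- by rewrite (leq_trans (mpoly.msizeD_le _ _)) // geq_max dp dq.
have [we|we] := leqP (weight e) d; last by rewrite a0 // scale0r mpoly.msize0.
rewrite (leq_trans (mpoly.msizeZ_le _ _)) // mpoly.msizeX mpoly.mdegE ltnS.
apply: leq_trans we; apply/eq_leq/eq_bigr => i _.
by rewrite mpoly.multinomE tnth_mktuple.
Qed.

End Polynomials.

(** * The lattice (1/B) Z^n as a copy of Z^n *)

Section LatticePoints.
Variables (R : realType) (n : nat) (B : R).

Definition lattice_point (z : 'rV[int]_n) : 'rV[R]_n := B^-1 *: map_mx intr z.

Lemma lattice_pointP z : lattice B (lattice_point z).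
Proof. by exists z. Qed.

Lemma lattice_pointD x y :
  lattice_point (x + y) = lattice_point x + lattice_point y.
Proof. by rewrite /lattice_point map_mxD scalerDr. Qed.

Lemma lattice_pointZ (t : int) x :
  lattice_point (t *: x) = t%:~R *: lattice_point x.
Proof.
by apply/rowP => i; rewrite !mxE rmorphM /= mulrCA.
Qed.

Lemma agrees_poly_on_lines d (f : 'rV[R]_n -> R) :
  agrees_with_degree d f (lattice B) -> poly_on_lines d (f \o lattice_point).
Proof.
move=> [p dp fp] x y.
have [q sq qE] := peval_line (lattice_point x) (lattice_point y) dp.
exists q => // t; rewrite /= fp; last exact: lattice_pointP.
by rewrite lattice_pointD lattice_pointZ qE.
Qed.

(** The factor B^(weight e) undoes the scaling by 1/B of the coordinates. *)
Lemma lattice_grid_poly d (a : {ffun 'I_n -> 'I_d.+1} -> R) : B != 0 ->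
  (forall e, (d < weight e)%N -> a e = 0) ->
  exists2 p : mpoly.mpoly n R, deg_le d p &
    forall z, peval p (lattice_point z) =
      \sum_e a e * \prod_i (z ord0 i)%:~R ^+ e i.
Proof.
move=> B0 a0; exists (grid_mpoly (fun e => a e * B ^+ weight e)).
  by apply: deg_le_grid_mpoly => e /a0 ->; rewrite mul0r.
move=> z; rewrite peval_grid_mpoly; apply: eq_bigr => e _.
rewrite -mulrA expr_sum -big_split; congr (_ * _); apply: eq_bigr => i _ /=.
by rewrite !mxE -exprMn mulVKf.
Qed.

(** With B' = k B, the point z / B equals (k z) / B'. *)
Lemma sub_lattice (B' : R) (k : nat) : B' = k%:R * B -> B' != 0 ->
  forall z, lattice B' (lattice_point z).
Proof.
move=> BE B'0 z; exists (k%:Z *: z) => //; apply/rowP => i.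
rewrite !mxE rmorphM /=.
move: B'0; rewrite BE mulf_eq0 negb_or => /andP[k0 B0].
by rewrite invfM mulrA; congr (_ * _); rewrite mulrAC mulVf // mul1r.
Qed.

(** Each coordinate is bounded by the Euclidean norm, and multiplication by B turns the radius r
    into B r. *)
Lemma inbox_lattice_point (r : R) (X : nat) z : 0 < B -> B * r <= X%:R ->
  eball 0 r (lattice_point z) -> inbox X z.
Proof.
move=> B0 BrX; rewrite /eball /= subr0 /euclidean_norm => zr i j.
rewrite ord1 -(ler_nat R); apply: le_trans BrX.
have -> : (`|z ord0 j|%N)%:R = B * `|lattice_point z ord0 j|.
  rewrite !mxE normrM gtr0_norm ?invr_gt0 // mulVKf ?gt_eqF //.
  by rewrite natr_absz intr_norm.
rewrite ler_wpM2l ?(ltW B0) // ltW // (le_lt_trans _ zr) //.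
rewrite -sqrtr_sqr ler_wsqrtr //.
by rewrite (bigD1 j) //= lerDl sumr_ge0 // => l _; rewrite sqr_ge0.
Qed.

End LatticePoints.

(** * The three phases of the tester *)

Section Tester.
Variables (R : realType) (n d : nat) (B : R) (M N : nat).
Hypotheses (M_gt0 : (0 < M)%N) (N_gt0 : (0 < N)%N).

Notation I := 'I_d.+1.
Notation box M := {ffun 'I_2 * 'I_n -> 'I_M}.
Notation lp := (lattice_point B).

(** The leading entry of weight -1 makes the residual the corrected value minus the value at [x]. *)
Definition corrected_check (x : 'rV[R]_n) (H : box M) : seq (R * 'rV[R]_n) :=
  (-1, x) :: [seq (cweight R s, x + lp (cvec s *m box_point H))
             | s <- enum {: I * I}].

Definition line_check (x y : 'rV[int]_n) : seq (R * 'rV[R]_n) :=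
  (-1, lp x) :: [seq (alpha R i, lp (x + i.+1%:Z *: y)) | i <- enum I].

Lemma residual_corrected f z H :
  residual f (corrected_check (lp z) H) =
  corrected d (f \o lp) z (box_point H) - f (lp z).
Proof.
rewrite /residual big_cons big_map big_enum /= mulN1r addrC; congr (_ + _).
by apply: eq_bigr => s _; rewrite /= lattice_pointD.
Qed.

Lemma residual_line f x y :
  residual f (line_check x y) = line_interp d (f \o lp) x y - f (lp x).
Proof. by rewrite /residual big_cons big_map big_enum /= mulN1r addrC. Qed.

Lemma size_corrected_check x H : size (corrected_check x H) = (d.+1 ^ 2).+1.
Proof. by rewrite /= size_map -cardE card_prod card_ord. Qed.

Lemma size_line_check x y : size (line_check x y) = d.+2.
Proof. by rewrite /= size_map -cardE card_ord. Qed.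

Lemma mem_corrected_check z H wx : wx \in corrected_check (lp z) H ->
  exists z', wx.2 = lp z'.
Proof.
rewrite inE => /predU1P[->|/mapP[s _ ->]]; first by exists z.
by eexists; rewrite -lattice_pointD.
Qed.

Lemma mem_line_check x y wx : wx \in line_check x y -> exists z', wx.2 = lp z'.
Proof. by rewrite inE => /predU1P[->|/mapP[s _ ->]]; eexists. Qed.

Definition checkA (t : (I * I) * (box M * box M)) : seq (R * 'rV[R]_n) :=
  corrected_check (lp (cvec t.1 *m box_point t.2.1)) t.2.2.

Definition checkB (t : (I * I) * (box M * box N)) : seq (R * 'rV[R]_n) :=
  line_check (cvec t.1 *m box_point t.2.1) (cvec t.1 *m box_point t.2.2).

Lemma card_typeA : (0 < #|{: (I * I) * (box M * box M)}|)%N.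
Proof. by rewrite !card_prod !card_ord !muln_gt0 card_box_gt0. Qed.

Lemma card_typeB : (0 < #|{: (I * I) * (box M * box N)}|)%N.
Proof. by rewrite !card_prod !card_ord !muln_gt0 !card_box_gt0. Qed.

(** The numbers of rounds are twice the inverses of the failure rates 1/(8 (d+2) (d+1)^2) and 1/(4
    (d+1)^2) that separate the cases of [tester_rejects], as [rejects_iter] demands. *)
Definition roundsA := (16 * d.+2 * d.+1 ^ 2)%N.
Definition roundsB := (8 * d.+1 ^ 2)%N.

Definition tester (roundsC : nat) : algorithm R n :=
  iter roundsA (check_round card_typeA checkA)
    (iter roundsB (check_round card_typeB checkB)
      (iter roundsC (sample_round (card_box_gt0 2 n M_gt0) corrected_check)
        (Output _ _ true))).

Definition tester_queries (roundsC : nat) : nat :=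
  roundsA * (d.+1 ^ 2).+1 + (roundsB * d.+2 + (roundsC * (d.+1 ^ 2).+1 + 0)).

Variables (f : 'rV[R]_n -> R) (D : discrete_distribution R 'rV[R]_n).
Hypothesis D_lattice : supported_on D (lattice B).

Lemma tester_within (A : set 'rV[R]_n) roundsC : (forall z, A (lp z)) ->
  within f D A (tester roundsC) (tester_queries roundsC).
Proof.
move=> lpA; apply: within_iter => [t i tA|].
  apply: within_check_round tA => [u|u wx]; first exact: size_corrected_check.
  by move=> /mem_corrected_check[z' ->].
apply: within_iter => [t i tA|].
  apply: within_check_round tA => [u|u wx]; first exact: size_line_check.
  by move=> /mem_line_check[z' ->].
apply: within_iter => [t i tA|]; last exact: within_Output.
apply: within_sample_round tA => [x u|x Dx u wx].
  exact: size_corrected_check.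
have [[z _ <-]|Lx] := pselect (lattice B x).
  by move=> /mem_corrected_check[z' ->].
by move: Dx; rewrite D_lattice // ltxx.
Qed.

Lemma tester_accepts roundsC :
  agrees_with_degree d f (lattice B) -> accepts f D (tester roundsC).
Proof.
move=> /agrees_poly_on_lines fp.
apply: accepts_iter => [t|]; first apply: accepts_check_round => u.
  by rewrite residual_corrected -poly_corrected // subrr.
apply: accepts_iter => [t|]; first apply: accepts_check_round => u.
  by rewrite residual_line -poly_line_interp // subrr.
apply: accepts_iter => [t|]; last by [].
apply: accepts_sample_round => x Dx u.
have [[z _ <-]|Lx] := pselect (lattice B x).
  by rewrite residual_corrected -poly_corrected // subrr.
by move: Dx; rewrite D_lattice // eqxx.
Qed.


(** A round of failure rate 0 already preserves the bound of its continuation, so the phases before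
    the decisive one do no harm. *)
Lemma rejects_iter_check (T : finType) (T_gt0 : (0 < #|T|)%N) l k m rho :
  0 <= rho <= 1 -> rejects f D k rho ->
  rejects f D (iter m (check_round T_gt0 l) k) rho.
Proof.
move=> rho01 rk; elim: m => //= m /(rejects_check_round T_gt0 (l := l) rho01).
by move=> /(_ 0 (freq_ge0 _ _)); rewrite subr0 mul1r subKr.
Qed.

End Tester.

(** * Events of a discrete distribution *)

Section Probability.
Variables (R : realType) (T : choiceType) (D : discrete_distribution R T).

Lemma Pr_ge0 A : (0 <= Pr D A)%E.
Proof. by apply: esum_ge0 => x _; rewrite lee_fin Defs.pmf_ge0. Qed.

Lemma le_Pr A A' : A `<=` A' -> (Pr D A <= Pr D A')%E.
Proof.
move=> AA'; rewrite /Pr esum_mkcond [leRHS]esum_mkcond; apply: le_esum => x _.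
case: ifPn => [/[!inE] /AA' A'x|_]; first by rewrite mem_set.
by case: ifP; rewrite // lee_fin Defs.pmf_ge0.
Qed.

Lemma PrT : Pr D setT = 1%E.
Proof. exact: Defs.pmf_sum1. Qed.

Lemma Pr_real A : exists u : R, Pr D A = u%:E.
Proof.
have := Pr_ge0 A; have : (Pr D A <= 1)%E by rewrite -PrT le_Pr.
by case: (Pr D A) => [u| |] //; exists u.
Qed.

Lemma PrID E A : Pr D A = (Pr D (A `&` E) + Pr D (A `&` ~` E))%E.
Proof. by rewrite /Pr (esumID E) // => x _; rewrite lee_fin Defs.pmf_ge0. Qed.

Lemma supported_PrI L A : supported_on D L -> Pr D (A `&` L) = Pr D A.
Proof.
move=> DL; rewrite [RHS](PrID L) [X in (_ + X)%E](_ : _ = 0%E) ?adde0 //.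
by apply: esum1 => x [_ /DL ->].
Qed.

(** The part of [A] outside [E] has probability at most that of the complement of [E], hence at most
    e'. *)
Lemma Pr_setI_ge (E A : set T) (e e' : R) :
  (e%:E < Pr D A)%E -> ((1 - e')%:E <= Pr D E)%E ->
  ((e - e')%:E <= Pr D (A `&` E))%E.
Proof.
move=> eA eE.
have leC : (Pr D (A `&` ~` E) <= Pr D (~` E))%E by apply: le_Pr => x [].
have := PrID E setT; rewrite PrT !setTI; move: eA eE leC; rewrite (PrID E A).
have [u ->] := Pr_real (A `&` E); have [v ->] := Pr_real (A `&` ~` E).
have [w ->] := Pr_real E; have [z ->] := Pr_real (~` E).
by rewrite -!EFinD !lee_fin lte_fin => ? ? ? []; lra.
Qed.

End Probability.

(** * Rejection of functions far from every polynomial *)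

Section Rejection.
Variables (R : realType) (n d : nat) (B : R) (M N X : nat).
Hypotheses (M_gt0 : (0 < M)%N) (N_gt0 : (0 < N)%N) (B_gt0 : 0 < B).
Hypotheses (X_gt0 : (0 < X)%N) (dX : (d <= X)%N) (ndX : (n * d * d <= X)%N).

(** Chosen so that (d+2) (d+1)^2 [slack] = 1/16, which keeps all translation losses together below
    the margin of the union bound. *)
Definition slack : R := (16 * d.+1 ^ 2 * d.+2)%:R^-1.

Hypotheses (thW : (2 * n * (d.+1 * (d.+2 * X)))%:R / M%:R <= slack)
           (thN : (2 * n * (d.+1 * N))%:R / M%:R <= slack)
           (thX : (2 * n * (d.+1 * X))%:R / N%:R <= slack).

Variables (f : 'rV[R]_n -> R) (D : discrete_distribution R 'rV[R]_n).
Variables (r eps : R) (roundsC : nat).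
Hypotheses (BrX : B * r <= X%:R) (eps_gt0 : 0 < eps) (eps_lt1 : eps < 1).
Hypotheses (D_lattice : supported_on D (lattice B))
           (D_conc : concentrated (eps / 4) r D)
           (f_far : far_from_degree d eps f D)
           (roundsC_large : 6 / eps <= roundsC%:R).

Notation I := 'I_d.+1.
Notation box M := {ffun 'I_2 * 'I_n -> 'I_M}.
Notation lp := (lattice_point B).
Notation F := (f \o lp).

Let rateA (s : I * I) := freq R (fun HH : box M * box M => badA F (s, HH)).
Let rateB (s : I * I) := freq R (fun HK : box M * box N => badB F (s, HK)).

Lemma freq_checkA : freq R (fun t => residual f (@checkA R n d B M t) != 0) =
  (\sum_(s : I * I) rateA s) / (d.+1 ^ 2)%:R.
Proof.
rewrite (eq_freq R (Q := @badA R n d F M)) => [|t]; last first.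
  by rewrite residual_corrected subr_eq0 eq_sym.
by rewrite freq_pair card_prod card_ord.
Qed.

Lemma freq_checkB : freq R (fun t => residual f (@checkB R n d B M N t) != 0) =
  (\sum_(s : I * I) rateB s) / (d.+1 ^ 2)%:R.
Proof.
rewrite (eq_freq R (Q := @badB R n d F M N)) => [|t]; last first.
  by rewrite residual_line subr_eq0 eq_sym.
by rewrite freq_pair card_prod card_ord.
Qed.

(** Small failure rates yield, by [self_correction], a polynomial p of degree at most d. As f is far
    from p and D concentrated, a sample is a lattice point of the ball with f different from p with
    probability at least 3 eps / 4; there the corrected value is p, hence not f, for at least half
    of the matrices. *)
Lemma rejects_sampling (k : algorithm R n) :
  8 * d.+2%:R * \sum_s rateA s <= 1 -> 4 * \sum_s rateB s <= 1 ->
  rejects f D (iter roundsC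
    (sample_round (card_box_gt0 2 n M_gt0) (@corrected_check R n d B M)) k)
    (2 / 3).
Proof.
move=> smallA smallB.
have Q1 : 1 <= (d.+1 ^ 2)%:R :> R by rewrite ler1n expn_gt0.
have e1 : 1 <= d.+2%:R :> R by rewrite ler1n.
have slack_eq : d.+2%:R * ((d.+1 ^ 2)%:R * slack) = 1 / 16.
  move: Q1 e1; rewrite /slack; move: (d.+1 ^ 2)%N d.+2 => Q e Q1 e1.
  rewrite !natrM.
  have Q0 := lt0r_neq0 (lt_le_trans ltr01 Q1).
  have e0 := lt0r_neq0 (lt_le_trans ltr01 e1).
  by field; rewrite Q0 e0.
have slack0 : 0 <= slack by rewrite invr_ge0.
have kappaE : kappa d F M slack =
    2 * (\sum_s rateA s + (d.+1 ^ 2)%:R * slack).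
  rewrite /kappa big_split /= sumr_const card_prod card_ord.
  by rewrite -[slack *+ _]mulr_natl.
have Qslack : (d.+1 ^ 2)%:R * slack <= 1 / 16.
  by rewrite -slack_eq ler_peMl // mulr_ge0.
have eslack : d.+2%:R * slack <= 1 / 16.
  by rewrite -slack_eq ler_wpM2l // ler_peMl.
have S0 : 0 <= \sum_s rateA s by apply: sumr_ge0 => s _; exact: freq_ge0.
have S_small : \sum_s rateA s <= 1 / 8.
  have : \sum_s rateA s <= d.+2%:R * \sum_s rateA s by rewrite ler_peMl.
  by move: smallA; rewrite -mulrA; lra.
have [||a a0 aP] := self_correction M_gt0 N_gt0 X_gt0 dX ndX thW thN thX
  (F := F).
(* The contributions are 1/4 + 1/8 from (d+2) [kappa], 1/16 from (d+2) [slack], then 1/4 + 1/8 from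
   the line checks: at most 13/16 in all. *)
- rewrite kappaE !big_split /= !sumr_const card_prod card_ord.
  rewrite -[slack *+ _]mulr_natl.
  rewrite -[(d.+1 * d.+1)%N]/(d.+1 ^ 2)%N.
  move: smallA smallB slack_eq Qslack eslack; rewrite -mulrA.
  move: (\sum_s rateA s) (\sum_s rateB s) ((d.+1 ^ 2)%:R * slack) => S S' w.
  rewrite mulrDr [d.+2%:R * (2 * _)]mulrCA mulrDr; lra.
- by rewrite kappaE; lra.
have [p dp pE] := lattice_grid_poly (lt0r_neq0 B_gt0) a0.
pose A := [set x | f x <> peval p x] `&` (eball 0 r `&` lattice B).
have PrA : ((eps - eps / 4)%:E <= Pr D A)%E.
  by apply: Pr_setI_ge (f_far dp) _; rewrite supported_PrI.
have half x : A x -> 1 / 2 <=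
    freq R (fun H => residual f (@corrected_check R n d B M x H) != 0).
  move=> [/= fx [xr [z _ zx]]]; move: zx fx xr => <- fx xr.
  have zX := inbox_lattice_point B_gt0 BrX xr.
  rewrite -[X in X <= _](_ : 1 - 1 / 2 = _); last by lra.
  apply: (@le_trans _ _ (1 - freq R (fun H : box M =>
     corrected d F z (box_point H) != peval p (lp z)))).
    by rewrite lerD2l lerN2 pE; exact: aP.
  rewrite -freq_neg; last exact: card_box_gt0.
  apply: sub_freq => H; rewrite negbK residual_corrected => /eqP ->.
  by rewrite subr_eq0 eq_sym; apply/eqP.
(* The rate is 3 eps / 8, and 6 / eps rounds give m a >= 9/4. *)
apply: (@rejects_iter _ _ _ _ _ ((eps - eps / 4) * (1 / 2))).
- by move: eps_gt0 eps_lt1 => ep0 ep1; apply/andP; split; lra.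
- have : 6 <= roundsC%:R * eps by rewrite -ler_pdivrMr.
  lra.
move=> t rho rho01 rt.
by apply: (rejects_sample_round _ rho01 _ PrA half rt); lra.
Qed.

(** Either the first check fails often, or the second does, or both rates are small and sampling
    rejects. Rates are averages over the (d+1)^2 values of s, which explains that factor. *)
Lemma tester_rejects : rejects f D (tester n d B M_gt0 N_gt0 roundsC) (2 / 3).
Proof.
have Q0 : 0 < (d.+1 ^ 2)%:R :> R by rewrite ltr0n expn_gt0.
have t23 : 0 <= (2 / 3 : R) <= 1 by apply/andP; split; lra.
have [bigA|smallA] := ltP 1 (8 * d.+2%:R * \sum_s rateA s).
  have D0 : 0 < 8 * d.+2%:R :> R by rewrite mulr_gt0.
  apply: (@rejects_iter _ _ _ _ _ ((8 * d.+2%:R * (d.+1 ^ 2)%:R)^-1)).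
  - rewrite invr_ge0 invf_le1; last by rewrite mulr_gt0.
    rewrite mulr_ge0 ?(ltW D0) ?(ltW Q0) //= -!natrM ler1n.
    by rewrite ?muln_gt0 ?expn_gt0.
  - rewrite /roundsA; move: D0 Q0; move: (d.+1 ^ 2)%N d.+2 => Q e D0 Q0.
    rewrite !natrM -[X in X <= _](mulfK (lt0r_neq0 (mulr_gt0 D0 Q0))).
    by rewrite ler_pM2r ?invr_gt0 ?mulr_gt0 //; lra.
  move=> t rho rho01 rt; apply: rejects_check_round => //.
  rewrite freq_checkA invfM ler_wpM2r ?invr_ge0 ?(ltW Q0) //.
  by rewrite -[X in X <= _]mul1r ler_pdivrMr // mulrC ltW.
apply: rejects_iter_check => //.
have [bigB|smallB] := ltP 1 (4 * \sum_s rateB s).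
  apply: (@rejects_iter _ _ _ _ _ ((4 * (d.+1 ^ 2)%:R)^-1)).
  - rewrite invr_ge0 invf_le1; last by rewrite mulr_gt0.
    by rewrite mulr_ge0 ?(ltW Q0) //= -!natrM ler1n ?muln_gt0 ?expn_gt0.
  - rewrite /roundsB; move: Q0; move: (d.+1 ^ 2)%N => Q Q0.
    have Q4 : 0 < 4 * Q%:R :> R by rewrite mulr_gt0.
    rewrite natrM -[X in X <= _](mulfK (lt0r_neq0 Q4)).
    by rewrite ler_pM2r ?invr_gt0 //; lra.
  move=> t rho rho01 rt; apply: rejects_check_round => //.
  rewrite freq_checkB invfM ler_wpM2r ?invr_ge0 ?(ltW Q0) //.
  by rewrite -[X in X <= _]mul1r ler_pdivrMr // mulrC ltW.
by apply: rejects_iter_check => //; exact: rejects_sampling.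
Qed.

End Rejection.

(** * Counting the queries *)

Section QueryCount.
Variable R : realType.

Lemma le_ratio (a b k : nat) : (a <= b)%N -> (0 < b)%N ->
  a%:R / (b * k)%:R <= k%:R^-1 :> R.
Proof.
move=> ab b0; rewrite natrM invfM mulrA ler_piMl ?invr_ge0 //.
by rewrite ler_pdivrMr ?ltr0n // mul1r ler_nat.
Qed.

(** This is ln x <= x - 1 divided by x. It absorbs d^2 / eps into the claimed bound even when eps is
    near 1 and the logarithm near 0. *)
Lemma inv_le_entropy (x : R) : 0 < x -> x^-1 <= 1 + x^-1 * ln x^-1.
Proof.
move=> x0; have := le_ln1Dx (x := x - 1); rewrite lnV // addrCA subrr addr0.
have x1 : -1 < x - 1 by lra.
move=> /(_ x1) lnx; have i0 : 0 < x^-1 by rewrite invr_gt0.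
have := ler_wpM2l (ltW i0) lnx; rewrite mulrBr mulVf ?gt_eqF // mulr1 mulrN.
lra.
Qed.

(** For eps above 1 the logarithm is negative; the term d^5, at least d^2, compensates by
    [inv_le_entropy]. *)
Lemma entropy_ge0 (d : nat) (eps : R) : (0 < d)%N -> 0 < eps ->
  0 <= d%:R ^+ 5 + d%:R ^+ 2 / eps * ln (1 / eps).
Proof.
move=> d0 e0; rewrite div1r -mulrA.
have d1 : 1 <= d%:R :> R by rewrite ler1n.
have le := inv_le_entropy e0.
have i0 : 0 < eps^-1 by rewrite invr_gt0.
have d25 : d%:R ^+ 2 <= d%:R ^+ 5 :> R by rewrite ler_weXn2l.
have d2 : 0 <= d%:R ^+ 2 :> R by rewrite exprn_ge0.
have pos : 0 <= 1 + eps^-1 * ln eps^-1 by lra.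
by have := mulr_ge0 d2 pos; lra.
Qed.

(** The first two phases cost at most (960 + 96) d^5 and sampling at most 35 d^2 / eps; after
    [inv_le_entropy] the coefficient of d^5 is 1056 + 35, below 1100. *)
Lemma tester_queries_le (d roundsC : nat) (eps : R) : (0 < d)%N ->
  0 < eps -> eps < 1 -> roundsC%:R <= 6 / eps + 1 ->
  (tester_queries d roundsC)%:R <=
  1100 * (d%:R ^+ 5 + d%:R ^+ 2 / eps * ln (1 / eps)).
Proof.
move=> d0 e0 e1 rC.
have fixed : (roundsA d * (d.+1 ^ 2).+1 + roundsB d * d.+2 <= 1056 * d ^ 5)%N.
  have Q4 : (d.+1 ^ 2 <= 4 * d ^ 2)%N.
    by rewrite -[(4 * _)%N](expnMn 2 d 2) leq_exp2r //; lia.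
  have Q5 : ((d.+1 ^ 2).+1 <= 5 * d ^ 2)%N.
    have d2 : (0 < d ^ 2)%N by rewrite expn_gt0 d0.
    by move: Q4 d2; lia.
  have d3 : (d.+2 <= 3 * d)%N by lia.
  have dA := leq_mul (leq_mul (leq_mul (leqnn 16) d3) Q4) Q5.
  have dB := leq_mul (leq_mul (leqnn 8) Q4) d3.
  have d35 : (d ^ 3 <= d ^ 5)%N by rewrite leq_pexp2l.
  apply: leq_trans (leq_add dA dB) _.
  have -> : (16 * (3 * d) * (4 * d ^ 2) * (5 * d ^ 2) = 960 * d ^ 5)%N.
    by rewrite !expnS expn0; lia.
  have -> : (8 * (4 * d ^ 2) * (3 * d) = 96 * d ^ 3)%N.
    by rewrite !expnS expn0; lia.
  lia.
have Q5 : ((d.+1 ^ 2).+1%:R <= 5 * d%:R ^+ 2 :> R).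
  have d1 : 1 <= d%:R :> R by rewrite ler1n.
  by rewrite -natr1 natrX -natr1; nra.
have rC' : roundsC%:R <= 7 * eps^-1.
  have : 1 <= eps^-1 by rewrite invf_ge1 // ltW.
  lra.
have var : (roundsC * (d.+1 ^ 2).+1)%:R <= 7 * eps^-1 * (5 * d%:R ^+ 2) :> R.
  by rewrite natrM ler_pM.
rewrite /tester_queries addn0 addnA natrD.
have d2 : 0 <= d%:R ^+ 2 :> R by rewrite exprn_ge0.
have d25 : d%:R ^+ 2 <= d%:R ^+ 5 :> R by rewrite ler_weXn2l // ler1n.
have ent := ler_wpM2l d2 (inv_le_entropy e0).
have ln0 : 0 <= ln eps^-1 by rewrite ln_ge0 // invf_ge1 // ltW.
have i0 : 0 < eps^-1 by rewrite invr_gt0.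
have fixedR : (roundsA d * (d.+1 ^ 2).+1 + roundsB d * d.+2)%:R <=
    1056 * d%:R ^+ 5 :> R by rewrite -natrX -natrM ler_nat.
have t0 : 0 <= d%:R ^+ 2 * (eps^-1 * ln eps^-1) by rewrite !mulr_ge0 // ltW.
rewrite div1r -mulrA; move: ent; rewrite mulrDr mulr1 => ent.
have varE : 7 * eps^-1 * (5 * d%:R ^+ 2) = 35 * (d%:R ^+ 2 * eps^-1) by ring.
by rewrite varE in var; lra.
Qed.

End QueryCount.

(** * Box sizes and numbers of rounds for given [n], [d], [B], [r] and [eps] *)

Theorem theorem1p3 (R : realType) :
  exists2 C : R, 0 < C &
  forall (n d : nat) (B r B' eps : R),
    (0 < n)%N -> (0 < d)%N -> 0 < B -> 0 < r -> 0 < eps ->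
    16 * Num.max (n%:R `^ (5 / 2 + 2 * d%:R) * d%:R ^+ (2 * d))
                 (B ^+ 2 * r ^+ 2 / Num.sqrt n%:R) <= B' ->
    (exists k : nat, B' = k%:R * B) ->
  let L : set 'rV[R]_n := lattice B in
  let L' : set 'rV[R]_n := lattice B' in
  let H : set (discrete_distribution R 'rV[R]_n) :=
    [set D | supported_on D L /\ concentrated (eps / 4) r D] in
  exists t : algorithm R n,
    one_sided_tester d eps L H t /\
    forall (f : 'rV[R]_n -> R) (D : discrete_distribution R 'rV[R]_n), H D ->
      query_complexity_le f D t
        (C * (d%:R ^+ 5 + d%:R ^+ 2 / eps * ln (1 / eps))) /\
      queries_only_in f D t L'.
Proof.
exists 1100; first by rewrite ltr0n.
move=> n d B r B' eps n0 d0 B0 r0 e0 B'_ge [k BE] L L' H.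
(* For eps >= 1 no function is eps-far, a probability being at most 1, so accepting without queries
   is correct. *)
have [e1|e1] := leP 1 eps.
  exists (Output _ _ true); split => [f D _|f D _].
    split=> [_|far]; first by [].
    have := far 0 _; rewrite /deg_le mpoly.msize0 => /(_ isT) lt.
    have := lt_le_trans lt (le_Pr D (@subsetT _ _)).
    by rewrite PrT lte_fin ltNge e1.
  split=> s /(within_Output L' 0%N)[s0 sL'] //.
  have /eqP -> : size s == 0%N by rewrite -leqn0.
  by rewrite mulr_ge0 ?entropy_ge0 ?ler0n.
(* [X] covers the ball of radius r as well as d and n d d. With c the inverse of [slack], [N] and
   then [M] are taken so large that the translation losses are at most 1/c; the sum in [M] serves
   translations of both sizes. *)
pose X := ((Num.trunc (B * r)).+1 + d + n * d * d)%N.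
pose c := (16 * d.+1 ^ 2 * d.+2)%N.
pose N := (2 * n * (d.+1 * X) * c)%N.
pose M := (2 * n * (d.+1 * (d.+2 * X + N)) * c)%N.
have X_gt0 : (0 < X)%N by rewrite /X !addSn.
have c_gt0 : (0 < c)%N by rewrite /c ?muln_gt0 ?expn_gt0.
have N_gt0 : (0 < N)%N by rewrite /N !muln_gt0 n0 X_gt0.
have M_gt0 : (0 < M)%N by rewrite /M !muln_gt0 n0 addn_gt0 N_gt0 orbT.
have BrX : B * r <= X%:R.
  by rewrite ltW // (lt_le_trans (truncnS_gt _)) // ler_nat /X -addnA leq_addr.
(* The lower bound on [B'] makes it positive, as [sub_lattice] requires. *)
have B'0 : B' != 0.
  rewrite gt_eqF // (lt_le_trans _ B'_ge) // mulr_gt0 // lt_max.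
  by rewrite mulr_gt0 ?powR_gt0 ?exprn_gt0 ?ltr0n.
pose roundsC := (Num.trunc (6 / eps)).+1.
have rC : 6 / eps <= roundsC%:R by rewrite ltW // truncnS_gt.
have rC' : roundsC%:R <= 6 / eps + 1.
  have /truncn_itv/andP[le _] : 0 <= 6 / eps by rewrite divr_ge0 // ltW.
  by rewrite /roundsC -natr1 lerD2r.
exists (tester n d B M_gt0 N_gt0 roundsC); split => [f D [DL Dc]|f D [DL _]].
  split=> [|far]; first exact: tester_accepts.
  apply: (tester_rejects (X := X) _ _ _ X_gt0 _ _ _ _ _ BrX e0 e1 DL Dc far
    rC) => //.
  - by rewrite /X addnAC leq_addl.
  - by rewrite /X leq_addl.
  - apply: le_ratio; last by rewrite !muln_gt0 n0 addn_gt0 N_gt0 orbT.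
    by rewrite !leq_mul2l leq_addr !orbT.
  - apply: le_ratio; last by rewrite !muln_gt0 n0 addn_gt0 N_gt0 orbT.
    by rewrite !leq_mul2l leq_addl !orbT.
  - by apply: le_ratio; rewrite // !muln_gt0 n0 X_gt0.
have inL' : within f D L' (tester n d B M_gt0 N_gt0 roundsC)
    (tester_queries d roundsC).
  by apply: (tester_within DL); exact: (sub_lattice BE B'0).
split=> s /inL'[size_s sL'] //.
by apply: le_trans (tester_queries_le d0 e0 e1 rC'); rewrite ler_nat.
Qed.
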